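(* Let $(G,\{A_v,\mathcal{L}_v,L_v,\rho_v\}_{v\in V},\{\phi_e\}_{e\in E})$ be a noncommutative Mauldin-Williams graph. Suppose that the graph $G$ has no sinks and no sources, and that for every $v\in V$ the state space $\mathcal{S}_v$ of $A_v$ equals the closed convex hull of $K_v$, where $(K_v)_{v\in V}$ is the unique invariant family of nonempty compact sets for the dual maps $\phi_e^*$. Let $\mathcal{X}$ be the associated $C^*$-correspondence over $A=\bigoplus_{v\in V}A_v$. Then the Cuntz-Pimsner algebra $\mathcal{O}_{\mathcal{X}}$ is isomorphic to the Cuntz-Krieger algebra $C^*(G)$ of $G$.
   Context: Graphs. A graph $G=(V,E,r,s)$ consists of finite sets $V$ and $E$ and maps $r,s:E\to V$ (range and source). No sinks means $s$ is surjective; no sources means $r$ is surjective. Rieffel metric. Let $A$ be a unital $C^*$-algebra, $\mathcal{L}(A)\subset A$ a dense subspace (Lipschitz elements) and $L$ a seminorm on $\mathcal{L}(A)$ (Lipschitz seminorm) such that $\{a\in\mathcal{L}(A):L(a)=0\}$ is exactly the set of scalar multiples of the identity. The Rieffel metric on the state space $\mathcal{S}$ of $A$ is $\rho(\mu,\nu)=\sup\{|\mu(a)-\nu(a)|:a\in\mathcal{L}(A),\ L(a)\le1\}$. It is always assumed that $\rho$ is bounded on $\mathcal{S}$ and that its topology is the weak-$*$ topology on $\mathcal{S}$. Noncommutative Mauldin-Williams graph. A system $(G,\{A_v,\mathcal{L}_v,L_v,\rho_v\}_{v\in V},\{\phi_e\}_{e\in E})$ where $G=(V,E,r,s)$ is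 a graph; each $A_v$ is a (nonzero) unital $C^*$-algebra with a Lipschitz seminorm $L_v$ on a subspace $\mathcal{L}_v\subset A_v$ of Lipschitz elements, and $\rho_v$ is the corresponding Rieffel metric on the state space $\mathcal{S}_v$ of $A_v$; and for each $e\in E$, $\phi_e:A_{s(e)}\to A_{r(e)}$ is a unital $*$-homomorphism with $\rho_{s(e)}(\phi_e^*(\mu),\phi_e^*(\nu))\le c\,\rho_{r(e)}(\mu,\nu)$ for all $\mu,\nu\in\mathcal{S}_{r(e)}$, for some constant $0<c<1$ (independent of $e$). Here $\phi_e^*(\mu)=\mu\circ\phi_e$. Invariant family. When $G$ has no sinks there is a unique family $(K_v)_{v\in V}$ of nonempty (weak-$*$) compact sets $K_v\subset\mathcal{S}_v$ with $K_v=\bigcup_{e\in E,\,s(e)=v}\phi_e^*(K_{r(e)})$ for all $v\in V$. The correspondence. With $A=\bigoplus_{v\in V}A_v$, let $\mathcal{X}$ be the set of families $\xi=(\xi_e)_{e\in E}$ of elements of $A$ such that $\xi_e$ lies in the summand $A_{r(e)}$ for each $e$, with $(\xi\cdot a)_e=\xi_e a_{r(e)}$, $(a\cdot\xi)_e=\phi_e(a_{s(e)})\xi_e$, and $\langle\xi,\eta\rangle_A=\sum_{e\in E}\xi_e^*\eta_e$, for $a=(a_v)_{v\in V}\in A$. The left action is the $*$-homomorphism $\Phi:A\to\mathcal{L}(\mathcal{X})$, $\Phi(a)\xi=a\cdot\xi$, into the adjointable operators. Cuntz-Pimsner algebra. A Toeplitz representation of $\mathcal{X}$ in a $C^*$-algebra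 $B$ is a pair $(\psi,\pi)$ with $\psi:\mathcal{X}\to B$ linear and $\pi:A\to B$ a $*$-homomorphism such that $\psi(\xi\cdot a)=\psi(\xi)\pi(a)$, $\psi(a\cdot\xi)=\pi(a)\psi(\xi)$ and $\psi(\xi)^*\psi(\eta)=\pi(\langle\xi,\eta\rangle_A)$. It induces a $*$-homomorphism $\pi^{(1)}:\mathcal{K}(\mathcal{X})\to B$ with $\pi^{(1)}(\Theta_{\xi,\eta})=\psi(\xi)\psi(\eta)^*$, where $\Theta_{\xi,\eta}(\zeta)=\xi\cdot\langle\eta,\zeta\rangle_A$ and $\mathcal{K}(\mathcal{X})$ is the closed linear span of the operators $\Theta_{\xi,\eta}$. Put $J(\mathcal{X})=\Phi^{-1}(\mathcal{K}(\mathcal{X}))$. The representation is Cuntz-Pimsner covariant if $\pi^{(1)}(\Phi(a))=\pi(a)$ for all $a\in J(\mathcal{X})$. $\mathcal{O}_{\mathcal{X}}$ is the $C^*$-algebra generated by a universal Cuntz-Pimsner covariant Toeplitz representation. Graph algebra. $C^*(G)$ is the universal $C^*$-algebra generated by mutually orthogonal projections $\{P_v\}_{v\in V}$ and partial isometries $\{S_e\}_{e\in E}$ with $S_e^*S_e=P_{r(e)}$ for $e\in E$ and $P_v=\sum_{s(f)=v}S_fS_f^*$ for $v\in s(E)$. *)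

(* Defs.v *)
From HB Require Import structures.
From mathcomp Require Import all_boot all_order all_algebra.
From mathcomp Require Import complex.
From mathcomp Require Import all_classical all_reals all_analysis.

Set Implicit Arguments.
Unset Strict Implicit.
Unset Printing Implicit Defensive.

Import Order.TTheory GRing.Theory Num.Theory.
Import numFieldNormedType.Exports.

Local Open Scope classical_set_scope.
Local Open Scope complex_scope.
Local Open Scope ring_scope.

Declare Scope cstar_scope.
Delimit Scope cstar_scope with cstar.
Local Open Scope cstar_scope.

(* The complex field is R[i]. Not necessarily unital; the zero algebra is allowed. *)
HB.mixin Record isCStarAlgebra (R : realType) A
    & CompleteNormedModule R[i] A := {
  cmul : A -> A -> A;
  star : A -> A;
  cmulA : associative cmul;
  cmulDl : left_distributive cmul +%R;
  cmulDr : right_distributive cmul +%R;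
  cmulZl : forall (k : R[i]) x y, cmul (k *: x) y = k *: cmul x y;
  cmulZr : forall (k : R[i]) x y, cmul x (k *: y) = k *: cmul x y;
  starD : {morph star : x y / x + y};
  starZ : forall (k : R[i]) x, star (k *: x) = k^* *: star x;
  starM : forall x y, star (cmul x y) = cmul (star y) (star x);
  starK : involutive star;
  normr_cmul : forall x y, `|cmul x y| <= `|x| * `|y|;
  normr_star_cmul : forall x, `|cmul (star x) x| = `|x| ^+ 2
}.

#[short(type="cstarAlgType")]
HB.structure Definition CStarAlgebra (R : realType) :=
  {A of CompleteNormedModule R[i] A & isCStarAlgebra R A}.

Notation "x ** y" := (cmul x y)
  (at level 40, left associativity) : cstar_scope.

HB.mixin Record isUnitalCStarAlgebra (R : realType) A
    & CStarAlgebra R A := {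
  cone : A;
  cmul1x : left_id cone cmul;
  cmulx1 : right_id cone cmul;
  cone_neq0 : cone != 0
}.

#[short(type="unitalCstarAlgType")]
HB.structure Definition UnitalCStarAlgebra (R : realType) :=
  {A of CStarAlgebra R A & isUnitalCStarAlgebra R A}.

Section StarHom.
Variables (R : realType) (A B : cstarAlgType R).

Record star_hom (f : A -> B) : Prop := StarHom {
  star_hom_linear : linear f;
  star_hom_cmul : {morph f : x y / x ** y};
  star_hom_star : {morph f : x / star x}
}.

Record cstar_subalgebra (D : set B) : Prop := CStarSubalgebra {
  csub0 : D 0;
  csubD : forall x y, D x -> D y -> D (x + y);
  csubZ : forall (k : R[i]) x, D x -> D (k *: x);
  csubM : forall x y, D x -> D y -> D (x ** y);
  csub_star : forall x, D x -> D (star x);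
  csub_closed : closed D
}.

Definition cstar_generated (gens : set B) : Prop :=
  forall D : set B, cstar_subalgebra D -> gens `<=` D -> D = setT.

Definition cstar_isomorphic : Prop :=
  exists2 h : A -> B, star_hom h & bijective h.

End StarHom.

Arguments cstar_isomorphic {R} A B.

Definition fam (R : realType) (I : finType) (B : I -> lmodType R[i]) : Type :=
  forall i, B i.

Section Fam.
Variables (R : realType) (I : finType) (B : I -> lmodType R[i]).
Implicit Types x y z : fam B.

HB.instance Definition _ := gen_eqMixin (fam B).
HB.instance Definition _ := gen_choiceMixin (fam B).

Let fam0 : fam B := fun=> 0.
Let famN x : fam B := fun i => - x i.
Let famD x y : fam B := fun i => x i + y i.
Let famZ (k : R[i]) x : fam B := fun i => k *: x i.

Let famDA : associative famD.
Proof. by move=> x y z; apply: functional_extensionality_dep => i; exact: addrA. Qed.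
Let famDC : commutative famD.
Proof. by move=> x y; apply: functional_extensionality_dep => i; exact: addrC. Qed.
Let fam0D : left_id fam0 famD.
Proof. by move=> x; apply: functional_extensionality_dep => i; exact: add0r. Qed.
Let famND : left_inverse fam0 famN famD.
Proof. by move=> x; apply: functional_extensionality_dep => i; exact: addNr. Qed.

HB.instance Definition _ :=
  GRing.isZmodule.Build (fam B) famDA famDC fam0D famND.

Let famZA a b x : famZ a (famZ b x) = famZ (a * b) x.
Proof. by apply: functional_extensionality_dep => i; exact: scalerA. Qed.
Let fam1Z : left_id 1 famZ.
Proof. by move=> x; apply: functional_extensionality_dep => i; exact: scale1r. Qed.
Let famZDr : right_distributive famZ +%R.
Proof. by move=> k x y; apply: functional_extensionality_dep => i; exact: scalerDr. Qed.
Let famZDl x : {morph famZ^~ x : a b / a + b}.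
Proof. by move=> a b; apply: functional_extensionality_dep => i; exact: scalerDl. Qed.

HB.instance Definition _ :=
  GRing.Zmodule_isLmodule.Build R[i] (fam B) famZA fam1Z famZDr famZDl.

Lemma famDE x y i : (x + y) i = x i + y i. Proof. by []. Qed.
Lemma famNE x i : (- x) i = - x i. Proof. by []. Qed.
Lemma famZE (k : R[i]) x i : (k *: x) i = k *: x i. Proof. by []. Qed.
Lemma fam0E i : (0 : fam B) i = 0. Proof. by []. Qed.

Definition fam_in (i : I) (b : B i) : fam B := dfwith (fun=> 0) i b.

End Fam.

Definition dsum (R : realType) (I : finType) (A : I -> cstarAlgType R) : Type :=
  fam (fun i => A i : lmodType R[i]).

Section DirectSum.
Variables (R : realType) (I : finType) (A : I -> cstarAlgType R).
Implicit Types x y z : dsum A.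

HB.instance Definition _ := GRing.Lmodule.on (dsum A).

(* Norms are elements of R[i]; [rnorm] is the norm as an element of R. *)
Let rnorm (B : cstarAlgType R) (b : B) : R := complex.Re `|b|.

Let rnormE (B : cstarAlgType R) (b : B) : (rnorm b)%:C = `|b|.
Proof. by rewrite /rnorm RRe_real// normr_real. Qed.

Let rnorm_ge0 (B : cstarAlgType R) (b : B) : 0 <= rnorm b.
Proof. by rewrite -ler0c rnormE. Qed.

Definition dsum_norm x : R[i] := (\big[Num.max/0]_(i : I) rnorm (x i))%:C.

Lemma dsum_normP x (c : R) : 0 <= c ->
  (dsum_norm x <= c%:C) <-> (forall i, `|x i| <= c%:C).
Proof.
move=> c0; rewrite /dsum_norm lecR; split=> [/bigmax_leP[_ h] i|h].
  by rewrite -rnormE lecR h.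
by apply/bigmax_leP; split=> // i _; rewrite -lecR rnormE h.
Qed.

Lemma dsum_norm_ge0 x : 0 <= dsum_norm x.
Proof.
by rewrite ler0c; elim/big_ind: _ => // a b a0 b0; rewrite le_max a0.
Qed.

Let dsum_normR x : exists2 c, 0 <= c & dsum_norm x = c%:C.
Proof. by eexists; [rewrite -ler0c; exact: dsum_norm_ge0|]. Qed.

Lemma le_dsum_norm x i : `|x i| <= dsum_norm x.
Proof.
have [c c0 xc] := dsum_normR x; rewrite xc.
by move: i; apply/dsum_normP; rewrite ?xc.
Qed.

Let ler_dsum_normD x y : dsum_norm (x + y) <= dsum_norm x + dsum_norm y.
Proof.
have [[c c0 xc] [d d0 yd]] := (dsum_normR x, dsum_normR y).
rewrite xc yd -rmorphD; apply/dsum_normP; first exact: addr_ge0.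
move=> i; rewrite rmorphD/= -xc -yd famDE.
by rewrite (le_trans (ler_normD _ _))// lerD// le_dsum_norm.
Qed.

Let dsum_normZ (k : R[i]) x : dsum_norm (k *: x) = `|k| * dsum_norm x.
Proof.
apply/eqP; rewrite eq_le; apply/andP; split.
  have [c c0 xc] := dsum_normR x.
  have kE : (complex.Re `|k|)%:C = `|k| by rewrite RRe_real// normr_real.
  rewrite xc -kE -rmorphM; apply/dsum_normP.
    by rewrite mulr_ge0// -ler0c kE.
  by move=> i; rewrite rmorphM/= kE -xc famZE normrZ ler_wpM2l// le_dsum_norm.
have [->|k0] := eqVneq k 0; first by rewrite normr0 mul0r dsum_norm_ge0.
rewrite -ler_pdivlMl ?normr_gt0//.
have [c c0 xc] := dsum_normR (k *: x).
have kE : (complex.Re `|k|^-1)%:C = `|k|^-1.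
  by rewrite RRe_real// realV normr_real.
rewrite xc -kE -rmorphM; apply/dsum_normP.
  by rewrite mulr_ge0// -ler0c kE invr_ge0.
move=> i; rewrite rmorphM/= kE -xc ler_pdivlMl ?normr_gt0//.
by rewrite -normrZ; exact: le_dsum_norm (k *: x) i.
Qed.

Let dsum_norm0_eq0 x : dsum_norm x = 0 -> x = 0.
Proof.
move=> x0; apply: functional_extensionality_dep => i.
by apply/eqP; rewrite -normr_le0 -x0 le_dsum_norm.
Qed.

HB.instance Definition _ := @Lmodule_isNormed.Build R[i] (dsum A)
  dsum_norm ler_dsum_normD dsum_normZ dsum_norm0_eq0.

Let dsum_complete (F : set_system (dsum A)) :
  ProperFilter F -> cauchy F -> cvg F.
Proof.
move=> FF /cauchy_ballP Fc.
have Fi i : cvg ((fun x : dsum A => x i) @ F).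
  apply: cauchy_cvg; apply/cauchy_ballP => e e0.
  rewrite near_map2.
  apply: filterS (Fc e e0) => -[x y] /=.
  rewrite -!ball_normE /=; apply: le_lt_trans.
  by have := le_dsum_norm (x - y) i; rewrite famDE famNE.
apply/cvg_ex; exists (fun i => lim ((fun x : dsum A => x i) @ F) : A i).
apply/cvgrPdist_le => e e0.
have eE : (complex.Re e)%:C = e by rewrite RRe_real// gtr0_real.
have : forall i, \forall x \near F,
    `|lim ((fun x : dsum A => x i) @ F) - x i| <= e.
  by move=> i; have /cvgrPdist_le := Fi i; exact.
move=> /filter_forall; apply: filterS => x xe.
rewrite -eE; apply/dsum_normP; first by rewrite -ler0c eE ltW.
by move=> i; rewrite eE; exact: xe.
Qed.

HB.instance Definition _ := Uniform_isComplete.Build (dsum A) dsum_complete.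

Let dsum_mul x y : dsum A := fun i => x i ** y i.
Let dsum_star x : dsum A := fun i => star (x i).

Let dsum_mulA : associative dsum_mul.
Proof. by move=> x y z; apply: functional_extensionality_dep => i; exact: cmulA. Qed.
Let dsum_mulDl : left_distributive dsum_mul +%R.
Proof. by move=> x y z; apply: functional_extensionality_dep => i; exact: cmulDl. Qed.
Let dsum_mulDr : right_distributive dsum_mul +%R.
Proof. by move=> x y z; apply: functional_extensionality_dep => i; exact: cmulDr. Qed.
Let dsum_mulZl (k : R[i]) x y : dsum_mul (k *: x) y = k *: dsum_mul x y.
Proof. by apply: functional_extensionality_dep => i; exact: cmulZl. Qed.
Let dsum_mulZr (k : R[i]) x y : dsum_mul x (k *: y) = k *: dsum_mul x y.
Proof. by apply: functional_extensionality_dep => i; exact: cmulZr. Qed.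
Let dsum_starD : {morph dsum_star : x y / x + y}.
Proof. by move=> x y; apply: functional_extensionality_dep => i; exact: starD. Qed.
Let dsum_starZ (k : R[i]) x : dsum_star (k *: x) = k^* *: dsum_star x.
Proof. by apply: functional_extensionality_dep => i; exact: starZ. Qed.
Let dsum_starM x y :
  dsum_star (dsum_mul x y) = dsum_mul (dsum_star y) (dsum_star x).
Proof. by apply: functional_extensionality_dep => i; exact: starM. Qed.
Let dsum_starK : involutive dsum_star.
Proof. by move=> x; apply: functional_extensionality_dep => i; exact: starK. Qed.

Let normr_dsum_mul x y : `|dsum_mul x y| <= `|x| * `|y|.
Proof.
rewrite !/(`|_ : dsum A|)/=.
have [[c c0 xc] [d d0 yd]] := (dsum_normR x, dsum_normR y).
rewrite xc yd -rmorphM; apply/dsum_normP; first exact: mulr_ge0.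
move=> i; rewrite rmorphM/= -xc -yd (le_trans (normr_cmul _ _))//.
by rewrite ler_pM// le_dsum_norm.
Qed.

Let normr_dsum_star x : `|dsum_mul (dsum_star x) x| = `|x| ^+ 2.
Proof.
rewrite !/(`|_ : dsum A|)/=; apply/eqP; rewrite eq_le; apply/andP; split.
  have [c c0 xc] := dsum_normR x.
  rewrite xc -rmorphXn; apply/dsum_normP; first exact: sqr_ge0.
  move=> i; rewrite rmorphXn/= -xc normr_star_cmul.
  by rewrite lerXn2r ?nnegrE// ?dsum_norm_ge0// le_dsum_norm.
have [d d0 yd] := dsum_normR (dsum_mul (dsum_star x) x).
suff xd : dsum_norm x <= (Num.sqrt d)%:C.
  rewrite yd -(sqr_sqrtr d0) rmorphXn/= lerXn2r ?nnegrE//.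
    exact: dsum_norm_ge0.
  by rewrite ler0c sqrtr_ge0.
apply/dsum_normP; first exact: sqrtr_ge0.
move=> i; rewrite -(@ler_pXn2r _ 2)// ?nnegrE ?ler0c ?sqrtr_ge0//.
rewrite -rmorphXn/= sqr_sqrtr// -yd -normr_star_cmul.
exact: le_dsum_norm (dsum_mul (dsum_star x) x) i.
Qed.

HB.instance Definition _ := isCStarAlgebra.Build R (dsum A)
  dsum_mulA dsum_mulDl dsum_mulDr dsum_mulZl dsum_mulZr
  dsum_starD dsum_starZ dsum_starM dsum_starK normr_dsum_mul normr_dsum_star.

End DirectSum.

(* Functionals carry the topology of pointwise convergence, which on the state
   space is the weak-* topology. *)
Definition functional (R : realType) (A : cstarAlgType R) : Type :=
  {ptws A -> R[i]^o}.

HB.instance Definition _ (R : realType) (A : cstarAlgType R) :=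
  Topological.on (functional A).

Section States.
Variables (R : realType) (A : unitalCstarAlgType R).

(* In R[i], [0 <= z] means that z is real and nonnegative. *)
Definition is_state (mu : functional A) : Prop :=
  [/\ linear (mu : A -> R[i]^o),
      forall a, 0 <= mu (star a ** a) & mu cone = 1].

Definition states : set (functional A) := [set mu | is_state mu].

Definition closed_convex_hull (K : set (functional A)) : set (functional A) :=
  \bigcap_(H in [set H : set (functional A) |
      [/\ K `<=` H, closed H &
          convex_set (H : set (convex_lmodType (A -> R[i]^o)))]]) H.

Variables (Lip : set A) (L : A -> R).

(* Extended-real valued, since finiteness is only part of the assumptions on L. *)
Definition rieffel_dist (mu nu : functional A) : \bar R :=
  ereal_sup [set (Normc.normc (mu a - nu a))%:E | a in
    [set a | Lip a /\ L a <= 1]].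

(* L is only meaningful on the subspace Lip. In [rieffel_topology], the left-hand
   side says that U is a weak-* neighbourhood of mu relative to the states. *)
Record lipschitz_structure : Prop := LipschitzStructure {
  Lip0 : Lip 0;
  LipD : forall a b, Lip a -> Lip b -> Lip (a + b);
  LipZ : forall (k : R[i]) a, Lip a -> Lip (k *: a);
  Lip_dense : dense Lip;
  lip_le : forall a b, Lip a -> Lip b -> L (a + b) <= L a + L b;
  lipZ : forall (k : R[i]) a, Lip a -> L (k *: a) = Normc.normc k * L a;
  lip_ker : [set a | Lip a /\ L a = 0] = [set k *: cone | k in [set: R[i]]];
  rieffel_bounded : exists M : R, forall mu nu,
    states mu -> states nu -> (rieffel_dist mu nu <= M%:E)%E;
  rieffel_topology : forall mu, states mu -> forall U : set (functional A),
    within states (nbhs mu) U <->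
    exists2 e : R, 0 < e &
      forall nu, states nu -> (rieffel_dist mu nu < e%:E)%E -> U nu
}.

End States.

Arguments states {R} A.

Record graph : Type := Graph {
  vertex : finType;
  edge : finType;
  rng : edge -> vertex;
  src : edge -> vertex
}.

Arguments rng {g} e.
Arguments src {g} e.

Definition no_sinks (G : graph) : Prop := forall v : vertex G, exists e, src e = v.
Definition no_sources (G : graph) : Prop := forall v : vertex G, exists e, rng e = v.

Section MauldinWilliams.
Variables (R : realType) (G : graph) (A : vertex G -> unitalCstarAlgType R).
Variable phi : forall e : edge G, A (src e) -> A (rng e).
Arguments phi : clear implicits.

Definition pullback (e : edge G) (mu : functional (A (rng e))) :
  functional (A (src e)) := fun a => mu (phi e a).

Record nc_mauldin_williams (Lip : forall v, set (A v)) (L : forall v, A v -> R) :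
    Prop := NCMauldinWilliams {
  mw_lip : forall v, lipschitz_structure (Lip v) (L v);
  mw_hom : forall e, star_hom (phi e);
  mw_unital : forall e, phi e cone = cone;
  mw_contraction : exists c : R, [/\ 0 < c, c < 1 &
    forall e (mu nu : functional (A (rng e))), states _ mu -> states _ nu ->
      (rieffel_dist (Lip (src e)) (L (src e)) (pullback mu) (pullback nu) <=
       c%:E * rieffel_dist (Lip (rng e)) (L (rng e)) mu nu)%E]
}.

(* [edge_image K v] is the union of the sets phi_e^*(K_(rng e)) over the edges e
   with src e = v; the inductive form avoids transporting along src e = v. *)
Inductive edge_image (K : forall v, set (functional (A v))) :
    forall v, functional (A v) -> Prop :=
  EdgeImage e mu of K (rng e) mu : edge_image K (pullback (e := e) mu).

Record invariant_family (K : forall v, set (functional (A v))) : Prop :=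
  InvariantFamily {
  inv_states : forall v, K v `<=` states (A v);
  inv_nonempty : forall v, K v !=set0;
  inv_compact : forall v, compact (K v);
  inv_eq : forall v, K v = edge_image K (v := v)
}.

End MauldinWilliams.

(* Only the operations of a C*-correspondence are recorded; the notions below do
   not depend on proofs of the Hilbert-module axioms. *)
Record correspondence (R : realType) (A : cstarAlgType R) := Correspondence {
  corr_sort :> lmodType R[i];
  ract : corr_sort -> A -> corr_sort;
  lact : A -> corr_sort -> corr_sort;
  inner : corr_sort -> corr_sort -> A
}.

Arguments ract {R A c} xi a.
Arguments lact {R A c} a xi.
Arguments inner {R A c} xi eta.

Section CuntzPimsner.
Variables (R : realType) (A : cstarAlgType R) (X : correspondence A).
Implicit Types (xi eta zeta : X) (T U : X -> X).

Definition corr_norm xi : R[i] := sqrtC `|inner xi xi|.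

Definition is_adjoint T U : Prop :=
  forall xi eta, inner (T xi) eta = inner xi (U eta).

Definition adjointable T : Prop := exists U, is_adjoint T U.

Definition rank_one xi eta : X -> X := fun zeta => ract xi (inner eta zeta).

(* T belongs to the closed linear span of the rank-one operators, for the
   operator norm. Linear combinations are sums of rank-one operators because
   scalars can be moved into the first argument. *)
Definition compact_op T : Prop :=
  adjointable T /\
  forall eps : R[i], 0 < eps -> exists s : seq (X * X), forall zeta,
    corr_norm (T zeta - \sum_(p <- s) rank_one p.1 p.2 zeta) <=
    eps * corr_norm zeta.

Section Representations.
Variables (B : cstarAlgType R) (psi : X -> B) (pi : A -> B).

Record toeplitz_rep : Prop := ToeplitzRep {
  toeplitz_linear : linear psi;
  toeplitz_hom : star_hom pi;
  toeplitz_ract : forall xi a, psi (ract xi a) = psi xi ** pi a;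
  toeplitz_lact : forall a xi, psi (lact a xi) = pi a ** psi xi;
  toeplitz_inner : forall xi eta, star (psi xi) ** psi eta = pi (inner xi eta)
}.

(* [pi1] is the *-homomorphism pi^(1) on the algebra of compact operators; its
   values at other operators are irrelevant. *)
Record induced_hom (pi1 : (X -> X) -> B) : Prop := InducedHom {
  induced_rank_one : forall xi eta,
    pi1 (rank_one xi eta) = psi xi ** star (psi eta);
  induced_linear : forall (k : R[i]) T U, compact_op T -> compact_op U ->
    pi1 (fun zeta => k *: T zeta + U zeta) = k *: pi1 T + pi1 U;
  induced_cmul : forall T U, compact_op T -> compact_op U ->
    pi1 (T \o U) = pi1 T ** pi1 U;
  induced_star : forall T U, compact_op T -> compact_op U -> is_adjoint T U ->
    pi1 U = star (pi1 T)
}.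

(* [pi1] is unique on the compact operators, whence [exists]. *)
Definition cp_covariant : Prop :=
  exists2 pi1, induced_hom pi1 &
    forall a : A, compact_op (lact a) -> pi1 (lact a) = pi a.

End Representations.

(* Uniqueness of the homomorphism h is a consequence of [cp_generated]. *)
Record cuntz_pimsner (O : cstarAlgType R) (psi : X -> O) (pi : A -> O) : Prop :=
  CuntzPimsner {
  cp_toeplitz : toeplitz_rep psi pi;
  cp_cov : cp_covariant psi pi;
  cp_generated : cstar_generated (range psi `|` range pi);
  cp_universal : forall (B : cstarAlgType R) (psi' : X -> B) (pi' : A -> B),
    toeplitz_rep psi' pi' -> cp_covariant psi' pi' ->
    exists h : O -> B, [/\ star_hom h, forall xi, h (psi xi) = psi' xi &
                           forall a, h (pi a) = pi' a]
}.

End CuntzPimsner.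

Arguments cuntz_pimsner {R A} X {O} psi pi.

Section MauldinWilliamsCorrespondence.
Variables (R : realType) (G : graph) (A : vertex G -> unitalCstarAlgType R).
Variable phi : forall e : edge G, A (src e) -> A (rng e).
Arguments phi : clear implicits.

Let X : lmodType R[i] := fam (fun e : edge G => A (rng e) : lmodType R[i]).
Let AA : cstarAlgType R := dsum (fun v => A v : cstarAlgType R).

Definition mw_correspondence : correspondence AA :=
  @Correspondence R AA X
    (fun xi a e => xi e ** a (rng e))
    (fun a xi e => phi e (a (src e)) ** xi e)
    (fun xi eta => \sum_(e : edge G)
       (fam_in (star (xi e) ** eta e) : AA)).

End MauldinWilliamsCorrespondence.

Section GraphAlgebra.
Variables (R : realType) (G : graph).

Record ck_family (B : cstarAlgType R) (P : vertex G -> B) (S : edge G -> B) :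
    Prop := CKFamily {
  ck_proj : forall v, star (P v) = P v /\ P v ** P v = P v;
  ck_orthogonal : forall v w, v != w -> P v ** P w = 0;
  ck_partial_isometry : forall e, S e ** star (S e) ** S e = S e;
  ck_source_proj : forall e, star (S e) ** S e = P (rng e);
  ck_sum : forall v, (exists e, src e = v) ->
    P v = \sum_(f : edge G | src f == v) S f ** star (S f)
}.

Record graph_cstar_algebra (C : cstarAlgType R) (P : vertex G -> C)
    (S : edge G -> C) : Prop := GraphCStarAlgebra {
  graph_ck : ck_family P S;
  graph_generated : cstar_generated (range P `|` range S);
  graph_universal : forall (B : cstarAlgType R) (Q : vertex G -> B)
      (T : edge G -> B),
    ck_family Q T ->
    exists h : C -> B, [/\ star_hom h, forall v, h (P v) = Q v &
                           forall e, h (S e) = T e]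
}.

End GraphAlgebra.

(* Main.v *)
(* Write [Phi_e a] for the element of the direct sum carried by the vertex
   [rng e] and equal there to [phi_e (a_(src e))]. In [O_X] covariance reads
   [pi a = \sum_e S_e pi(Phi_e a) S_e^*] with [S_e = psi 1_e], so the [S_e] and
   [P_v = pi 1_v] form a Cuntz-Krieger family. Iterating, [pi a] is a sum over
   words [w] of [S_w pi(Phi_w a) S_w^*]; the contraction hypothesis makes the
   oscillation of [Phi_w a] over the states tend to 0 uniformly in [w], hence
   [Phi_w a] is almost scalar in norm and [pi a] is determined by the family.
   Conversely, in [C*(G)] the sums [\sum_w nu(Phi_w a) S_w S_w^*], for any choice
   of states [nu], converge to a *-homomorphism fixed by the same recursion,
   which yields a covariant representation of [X]. The two homomorphisms given
   by the universal properties are then mutually inverse. Contractivity of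
   *-homomorphisms, positivity of [a^* a] and the existence of states are all
   derived from the iteration [c := (u + c^2) / 2] for [1 - sqrt (1 - u)]. *)

Require Import Defs.
From HB Require Import structures.
From mathcomp Require Import all_boot all_order all_algebra.
From mathcomp Require Import complex.
From mathcomp Require Import all_classical all_reals all_analysis.
From mathcomp Require Import ring lra.

Set Implicit Arguments.
Unset Strict Implicit.
Unset Printing Implicit Defensive.

Import Order.TTheory GRing.Theory Num.Theory.
Import numFieldNormedType.Exports.

Local Open Scope classical_set_scope.
Local Open Scope complex_scope.
Local Open Scope ring_scope.
Local Open Scope cstar_scope.

(** * Linear identities *)

(** Two obstacles shape the proof. The recursion is iterated arbitrarily often, so
    [\sum_e S_e b_e S_e^*] must be bounded by the largest [|b_e|], with no factor counting edges.
    This needs orthogonal ranges of the [S_e], which [ck_family] does not postulate: they are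
    deduced from the fact that the range projections at a vertex add up to a projection. Moreover
    [O], [C] and the targets of the universal properties carry no unit, so arguments there use
    identities between products in place of spectra: a square root enters through [c] with
    [2 c = u + c^2], which makes sense without [1], and order estimates become norm estimates for
    sums of commuting squares. Positivity and states are treated in the unital [A v] only.
    Covariance constrains every element of the direct sum, because the edge units form a finite
    basis of the correspondence and the left action is therefore by finite-rank operators. *)

Section LinearReflection.
Variables (K : comNzRingType) (V : lmodType K).

Inductive linexpr : Type :=
| LinAtom of nat
| LinZero
| LinAdd of linexpr & linexpr
| LinOpp of linexpr
| LinScale of K & linexpr.

Fixpoint lin_eval (vs : seq V) (e : linexpr) : V :=
  match e with
  | LinAtom i => nth 0 vs i
  | LinZero => 0
  | LinAdd e1 e2 => lin_eval vs e1 + lin_eval vs e2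
  | LinOpp e1 => - lin_eval vs e1
  | LinScale k e1 => k *: lin_eval vs e1
  end.

Fixpoint lin_coef (i : nat) (e : linexpr) : K :=
  match e with
  | LinAtom j => if eqn i j then 1 else 0
  | LinZero => 0
  | LinAdd e1 e2 => lin_coef i e1 + lin_coef i e2
  | LinOpp e1 => - lin_coef i e1
  | LinScale k e1 => k * lin_coef i e1
  end.

Lemma lin_evalE vs e :
  lin_eval vs e = \sum_(i < size vs) lin_coef i e *: nth 0 vs i.
Proof.
elim: e => /= [j||e1 -> e2 ->|e1 ->|k e1 ->].
- have [jv|jv] := ltnP j (size vs).
    rewrite (bigD1 (Ordinal jv))//= (introT eqnP erefl) scale1r big1 ?addr0//.
    move=> i ij; case: eqnP => [e|_]; last exact: scale0r.
    by case/eqP: ij; exact: val_inj.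
  rewrite nth_default// big1// => i _; case: eqnP => [ij|_]; last exact: scale0r.
  by have := ltn_ord i; rewrite ij ltnNge jv.
- by rewrite big1// => i _; rewrite scale0r.
- by rewrite -big_split; apply: eq_bigr => i _; rewrite scalerDl.
- by rewrite -sumrN; apply: eq_bigr => i _; rewrite scaleNr.
- by rewrite scaler_sumr; apply: eq_bigr => i _; rewrite scalerA.
Qed.

(** A recursive conjunction, which [cbn] unfolds at a concrete list of atoms into one coefficient
    equation per atom, each left to [field]. *)
Fixpoint lin_same_coefs (n : nat) (e f : linexpr) : Prop :=
  match n with
  | 0 => True
  | m.+1 => lin_coef m e = lin_coef m f /\ lin_same_coefs m e f
  end.

Lemma lin_eval_eq vs e f :
  lin_same_coefs (size vs) e f -> lin_eval vs e = lin_eval vs f.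
Proof.
rewrite !lin_evalE => ef; apply: eq_bigr => i _; congr (_ *: _).
elim: (size vs) ef (nat_of_ord i) (ltn_ord i) => // n IH [efn /IH{}IH] j.
by rewrite ltnS leq_eqVlt => /orP[/eqP->|/IH].
Qed.

End LinearReflection.

Ltac lin_index vs x :=
  lazymatch vs with
  | x :: _ => constr:(0%N)
  | _ :: ?vs' => let i := lin_index vs' x in constr:(i.+1)
  end.

Ltac lin_insert vs x :=
  match vs with
  | _ => let _ := lin_index vs x in vs
  | _ => constr:(x :: vs)
  end.

Ltac lin_atoms vs e :=
  lazymatch e with
  | GRing.zero => vs
  | GRing.add ?a ?b => let vs' := lin_atoms vs a in lin_atoms vs' b
  | GRing.opp ?a => lin_atoms vs a
  | GRing.scale _ ?a => lin_atoms vs a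
  | _ => lin_insert vs e
  end.

Ltac lin_reify K vs e :=
  lazymatch e with
  | GRing.zero => constr:(@LinZero K)
  | GRing.add ?a ?b =>
      let a' := lin_reify K vs a in
      let b' := lin_reify K vs b in constr:(@LinAdd K a' b')
  | GRing.opp ?a => let a' := lin_reify K vs a in constr:(@LinOpp K a')
  | GRing.scale ?k ?a => let a' := lin_reify K vs a in constr:(@LinScale K k a')
  | _ => let i := lin_index vs e in constr:(@LinAtom K i)
  end.

(* Proves an equality between linear combinations whose coefficients agree up
   to [field]; products of vectors are treated as atoms. *)
Ltac linear_combination K :=
  rewrite ?mulr2n;
  lazymatch goal with
  | |- @eq ?V ?a ?b =>
      let vs := lin_atoms (@nil V) a in
      let vs := lin_atoms vs b in
      let a' := lin_reify K vs a in
      let b' := lin_reify K vs b in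
      refine (@lin_eval_eq K _ vs a' b' _);
      cbn [lin_same_coefs lin_coef size eqn];
      repeat split; try by field
  end.

(** * C*-algebras *)

(** Norms live in [R[i]]; this real-valued copy is open to [lra], [nra] and the total order of
    [R]. *)
Definition nm (R : realType) (A : cstarAlgType R) (x : A) : R := complex.Re `|x|.

Section CStarBasics.
Variables (R : realType) (A : cstarAlgType R).
Implicit Types (x y z : A) (k : R[i]) (t : R).

Lemma cmulBl x y z : (x - y) ** z = x ** z - y ** z.
Proof. by rewrite -scaleN1r cmulDl cmulZl scaleN1r. Qed.
Lemma cmulBr x y z : z ** (x - y) = z ** x - z ** y.
Proof. by rewrite -scaleN1r cmulDr cmulZr scaleN1r. Qed.
Lemma cmul0r x : 0 ** x = 0.
Proof. by rewrite -[0 in LHS](scale0r x) cmulZl scale0r. Qed.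
Lemma cmulr0 x : x ** 0 = 0.
Proof. by rewrite -[0 in LHS](scale0r x) cmulZr scale0r. Qed.
Lemma cmulNl x y : (- x) ** y = - (x ** y).
Proof. by rewrite -sub0r cmulBl cmul0r sub0r. Qed.
Lemma cmulNr x y : x ** (- y) = - (x ** y).
Proof. by rewrite -sub0r cmulBr cmulr0 sub0r. Qed.

Lemma cmul_suml (I : Type) (r : seq I) (Q : pred I) (F : I -> A) x :
  (\sum_(i <- r | Q i) F i) ** x = \sum_(i <- r | Q i) F i ** x.
Proof. by rewrite (big_morph (cmul^~ x) (fun a b => cmulDl a b x) (cmul0r x)). Qed.
Lemma cmul_sumr (I : Type) (r : seq I) (Q : pred I) (F : I -> A) x :
  x ** (\sum_(i <- r | Q i) F i) = \sum_(i <- r | Q i) x ** F i.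
Proof. by rewrite (big_morph (cmul x) (cmulDr x) (cmulr0 x)). Qed.

Lemma star0 : star (0 : A) = 0.
Proof. by rewrite -[0 in LHS](scale0r (0 : A)) starZ rmorph0 scale0r. Qed.
Lemma starN x : star (- x) = - star x.
Proof. by rewrite -scaleN1r starZ rmorphN rmorph1 scaleN1r. Qed.
Lemma starB x y : star (x - y) = star x - star y.
Proof. by rewrite starD starN. Qed.
Lemma star_sum (I : Type) (r : seq I) (Q : pred I) (F : I -> A) :
  star (\sum_(i <- r | Q i) F i) = \sum_(i <- r | Q i) star (F i).
Proof. by rewrite (big_morph star (@starD _ A) star0). Qed.
Lemma starZr t x : star (t%:C *: x) = t%:C *: star x.
Proof. by rewrite starZ conj_Creal// complex_real. Qed.

Lemma nmE x : (nm x)%:C = `|x|.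
Proof. by rewrite /nm RRe_real// normr_real. Qed.
Lemma nm_le x t : (`|x| <= t%:C) = (nm x <= t).
Proof. by rewrite -nmE lecR. Qed.
Lemma nm_ge0 x : 0 <= nm x.
Proof. by rewrite -ler0c nmE. Qed.
Lemma nm0 : nm (0 : A) = 0.
Proof. by rewrite /nm normr0. Qed.
Lemma nm_eq0 x : nm x = 0 -> x = 0.
Proof. by move=> x0; apply/normr0_eq0; rewrite -nmE x0. Qed.
Lemma nmN x : nm (- x) = nm x.
Proof. by rewrite /nm normrN. Qed.
Lemma nmD x y : nm (x + y) <= nm x + nm y.
Proof. by rewrite -lecR rmorphD/= !nmE ler_normD. Qed.
Lemma nmB x y : nm (x - y) <= nm x + nm y.
Proof. by rewrite -(nmN y) nmD. Qed.
Lemma nm_distC x y : nm (x - y) = nm (y - x).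
Proof. by rewrite -nmN opprB. Qed.
Lemma nmM x y : nm (x ** y) <= nm x * nm y.
Proof. by rewrite -lecR rmorphM/= !nmE normr_cmul. Qed.
Lemma nm_star_mul x : nm (star x ** x) = nm x ^+ 2.
Proof. by apply: complexI; rewrite rmorphXn/= !nmE normr_star_cmul. Qed.
Lemma nmZ k x : nm (k *: x) = Normc.normc k * nm x.
Proof. by apply: complexI; rewrite rmorphM/= !nmE normrZ. Qed.
Lemma nmZr t x : nm (t%:C *: x) = `|t| * nm x.
Proof. by rewrite nmZ /= expr0n addr0 sqrtr_sqr. Qed.
Lemma nm_sum (I : Type) (r : seq I) (Q : pred I) (F : I -> A) :
  nm (\sum_(i <- r | Q i) F i) <= \sum_(i <- r | Q i) nm (F i).
Proof.
elim/big_ind2: _ => [|a b c d ab cd|//]; first by rewrite nm0.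
by rewrite (le_trans (nmD _ _))// lerD.
Qed.

Lemma nm_star x : nm (star x) = nm x.
Proof.
have le_star (y : A) : nm y <= nm (star y).
  have [->|y0] := eqVneq (nm y) 0; first exact: nm_ge0.
  have yp : 0 < nm y by rewrite lt_neqAle eq_sym y0 nm_ge0.
  by rewrite -(ler_pM2r yp) -expr2 -nm_star_mul nmM.
by apply/le_anti; rewrite le_star -{2}(starK x) le_star.
Qed.

Lemma nm_sa_sqr x : star x = x -> nm (x ** x) = nm x ^+ 2.
Proof. by move=> xs; rewrite -nm_star_mul xs. Qed.

Lemma star_mul_eq0 x : star x ** x = 0 -> x = 0.
Proof.
by move=> x0; apply: nm_eq0; apply/eqP; rewrite -sqrf_eq0 -nm_star_mul x0 nm0.
Qed.

Lemma nm_small_eq0 x : (forall e, 0 < e -> nm x <= e) -> x = 0.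
Proof.
move=> h; apply: nm_eq0; apply/le_anti; rewrite nm_ge0 andbT.
by apply/ler_addgt0Pl => e e0; rewrite addr0 h.
Qed.

Lemma nm_cauchy_lim (u : nat -> A) :
  (forall e, 0 < e -> exists N, forall m n,
     (N <= m)%N -> (N <= n)%N -> nm (u m - u n) <= e) ->
  exists l, forall e, 0 < e -> exists N, forall n,
     (N <= n)%N -> nm (l - u n) <= e.
Proof.
move=> uc; suff /cvg_ex[l ul] : cvg (u @ \oo).
  exists l => e e0; move/cvgrPdist_le : ul => /(_ e%:C).
  rewrite ltcR => /(_ e0)[N _ Nu]; exists N => n Nn.
  by rewrite -nm_le; exact: Nu.
apply: cauchy_cvg; apply/cauchy_ballP => e e0.
have eE : (complex.Re e)%:C = e by rewrite RRe_real// gtr0_real.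
have e2 : 0 < complex.Re e / 2 by rewrite divr_gt0// -ltcR eE.
have [N Nu] := uc _ e2.
pose tl : set A := [set u n | n in [set n | (N <= n)%N]].
have tlF : (u @ \oo) tl by exists N => // n Nn; exists n.
exists (tl, tl) => // -[_ _] [/= [m Nm <-] [n Nn <-]].
rewrite -ball_normE /= -eE -nmE ltcR (@le_lt_trans _ _ (complex.Re e / 2))//.
  exact: Nu.
by rewrite ltr_pdivrMr// ltr_pMr ?ltr1n// -ltcR eE.
Qed.

End CStarBasics.

(** * Square roots and contractivity of *-homomorphisms *)

Section SquareRoot.
Variable R : realType.

(** The iteration [c := (u + c^2) / 2] at the scalar [u = 1]. It dominates the iteration in [A] both
    term by term and increment by increment, so its convergence transfers. *)
Fixpoint sqrt_majorant (n : nat) : R :=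
  if n is m.+1 then (1 + sqrt_majorant m ^+ 2) / 2 else 0.

Lemma sqrt_majorant_itv n : 0 <= sqrt_majorant n <= 1.
Proof. by elim: n => [|n /= /andP[g0 g1]]; rewrite ?lexx ?ler01//; apply/andP; split; nra. Qed.

Lemma sqrt_majorant_nd : nondecreasing_seq sqrt_majorant.
Proof.
apply/nondecreasing_seqP => n /=.
by have /andP[g0 g1] := sqrt_majorant_itv n; nra.
Qed.

Lemma sqrt_majorant_cauchy e : 0 < e -> exists N, forall m n,
  (N <= n <= m)%N -> sqrt_majorant m - sqrt_majorant n <= e.
Proof.
move=> e0; have : cvgn sqrt_majorant.
  apply: nondecreasing_is_cvgn; first exact: sqrt_majorant_nd.
  by exists 1 => _ [n _ <-]; have /andP[] := sqrt_majorant_itv n.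
move=> /cvg_ex[l /cvgrPdist_le] /(_ (e / 2)); rewrite divr_gt0// => /(_ isT).
move=> [N _ gN]; exists N => m n /andP[Nn nm].
have := gN n Nn; have := gN m (leq_trans Nn nm).
rewrite /= !ler_norml => /andP[? ?] /andP[? ?]; lra.
Qed.

Variable A : cstarAlgType R.
Implicit Types (u c x y z : A).

Let half : R[i] := (2^-1 : R)%:C.
Let two_half : half + half = 1.
Proof. by rewrite /half -(rmorphD (real_complex R)) -(rmorph1 (real_complex R)); congr (_%:C); field. Qed.

Variable u : A.
Hypotheses (usa : star u = u) (u1 : nm u <= 1).

Fixpoint sqrt_iter (n : nat) : A :=
  if n is m.+1 then half *: (u + sqrt_iter m ** sqrt_iter m) else 0.

Lemma nm_half x : nm (half *: x) = nm x / 2.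
Proof. by rewrite nmZr ger0_norm ?invr_ge0// mulrC. Qed.

Lemma sqrt_iter_sa n : star (sqrt_iter n) = sqrt_iter n.
Proof. by elim: n => [|n IH] /=; rewrite ?star0// starZr starD starM IH usa. Qed.

Lemma sqrt_iter_comm z : z ** u = u ** z ->
  forall n, z ** sqrt_iter n = sqrt_iter n ** z.
Proof.
move=> zu; elim=> [|n IH] /=; first by rewrite cmulr0 cmul0r.
by rewrite cmulZr cmulZl cmulDr cmulDl zu cmulA IH -cmulA IH cmulA.
Qed.

Lemma nm_sqrt_iter n : nm (sqrt_iter n) <= sqrt_majorant n.
Proof.
elim: n => [|n IH] /=; first by rewrite nm0.
rewrite nm_half ler_pM2r ?invr_gt0// (le_trans (nmD _ _))// lerD//.
by rewrite (le_trans (nmM _ _))// expr2 ler_pM ?nm_ge0.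
Qed.

Lemma nm_sqr_sub x y : nm (x ** x - y ** y) <= (nm x + nm y) * nm (x - y).
Proof.
have -> : x ** x - y ** y = x ** (x - y) + (x - y) ** y.
  by rewrite cmulBr cmulBl addrA subrK.
by rewrite (le_trans (nmD _ _))// mulrDl [nm y * _]mulrC lerD// nmM.
Qed.

(** An increment is half a difference of squares, which [nm_sqr_sub] bounds without any commutation;
    the scalar increments satisfy the same relation with equality. *)
Lemma sqrt_iter_step n :
  nm (sqrt_iter n.+1 - sqrt_iter n) <= sqrt_majorant n.+1 - sqrt_majorant n.
Proof.
elim: n => [|n IH].
  by rewrite /= cmul0r addr0 !subr0 nm_half expr0n addr0 ler_pM2r ?invr_gt0.
have -> : sqrt_iter n.+2 - sqrt_iter n.+1 = half *:
    (sqrt_iter n.+1 ** sqrt_iter n.+1 - sqrt_iter n ** sqrt_iter n).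
  rewrite [sqrt_iter n.+2]/= [X in _ - X = _]/= -scalerBr; congr (_ *: _).
  by rewrite opprD addrACA subrr add0r.
rewrite nm_half; apply: (@le_trans _ _ ((sqrt_majorant n.+1 + sqrt_majorant n)
  * (sqrt_majorant n.+1 - sqrt_majorant n) / 2)).
  rewrite ler_pM2r ?invr_gt0// (le_trans (nm_sqr_sub _ _))//.
  by rewrite ler_pM ?addr_ge0 ?nm_ge0// lerD// nm_sqrt_iter.
have majS k : sqrt_majorant k.+1 = (1 + sqrt_majorant k ^+ 2) / 2 by [].
by rewrite [sqrt_majorant n.+2]majS [X in _ <= _ - X]majS; lra.
Qed.

Lemma sqrt_iter_dist m n : (n <= m)%N ->
  nm (sqrt_iter m - sqrt_iter n) <= sqrt_majorant m - sqrt_majorant n.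
Proof.
elim: m => [|m IH]; first by rewrite leqn0 => /eqP->; rewrite subrr nm0 subrr.
rewrite leq_eqVlt => /predU1P[->|]; first by rewrite !subrr nm0.
rewrite ltnS => /IH{}IH; rewrite -(subrKA (sqrt_iter m)) (le_trans (nmD _ _))//.
by rewrite -[leRHS](subrKA (sqrt_majorant m)) lerD// sqrt_iter_step.
Qed.

(* [c] is [1 - sqrt (1 - u)], in a form that makes sense without a unit. *)
Lemma cstar_sqrt : exists c : A, [/\ star c = c, nm c <= 1,
  c + c = u + c ** c & forall z, z ** u = u ** z -> z ** c = c ** z].
Proof.
have [|c cl] := @nm_cauchy_lim _ _ sqrt_iter.
  move=> e /sqrt_majorant_cauchy[N gN]; exists N => m n Nm Nn.
  wlog nm : m n Nm Nn / (n <= m)%N.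
    move=> h; have [nm|/ltnW mn] := leqP n m; first exact: h.
    by rewrite nm_distC h.
  by rewrite (le_trans (sqrt_iter_dist nm))// gN// Nn.
(* Passage to the limit for identities [F x = 0]: a Lipschitz bound between [c] and the iterates
   suffices. It is used for self-adjointness, the fixed-point equation and commutation. *)
have lim0 (F : A -> A) (M : R) : 0 <= M ->
    (forall n, nm (F c - F (sqrt_iter n)) <= M * nm (c - sqrt_iter n)) ->
    (forall e, 0 < e -> exists N, forall n, (N <= n)%N ->
       nm (F (sqrt_iter n)) <= e) -> F c = 0.
  move=> M0 FM F0; apply/nm_small_eq0 => e e0.
  have M1 : 0 < M + 1 by rewrite ltr_wpDl.
  have [|N cN] := cl (e / 2 / (M + 1)); first by rewrite !divr_gt0.
  have [|N' FN] := F0 (e / 2); first by rewrite divr_gt0.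
  have := cN _ (leq_maxl N N'); rewrite ler_pdivlMr// => h1.
  have := FN _ (leq_maxr N N') => h2.
  have := FM (maxn N N'); set n := maxn N N' in h1 h2 *.
  have := nmD (F c - F (sqrt_iter n)) (F (sqrt_iter n)); rewrite subrK.
  by have := nm_ge0 (c - sqrt_iter n); nra.
have c1 : nm c <= 1.
  apply/ler_addgt0Pr => e /cl[N /(_ N (leqnn _)) cN].
  rewrite -[c](subrK (sqrt_iter N)) (le_trans (nmD _ _))// addrC lerD//.
  by rewrite (le_trans (nm_sqrt_iter N))//; have /andP[] := sqrt_majorant_itv N.
have s1 n : nm (sqrt_iter n) <= 1.
  by rewrite (le_trans (nm_sqrt_iter n))//; have /andP[] := sqrt_majorant_itv n.
exists c; split => //.
- apply/subr0_eq; apply: (lim0 (fun x => star x - x) 2) => // [n|e e0].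
    rewrite sqrt_iter_sa subrr subr0.
    have -> : star c - c = star (c - sqrt_iter n) - (c - sqrt_iter n).
      by rewrite starB sqrt_iter_sa; linear_combination R[i].
    by rewrite (le_trans (nmB _ _))// nm_star mulr2n mulrDl mul1r.
  by exists 0%N => n _; rewrite sqrt_iter_sa subrr nm0 ltW.
- apply/subr0_eq.
  (* The 4 is 2 from [x + x] plus [nm c + nm s <= 2] from [nm_sqr_sub]. *)
  apply: (lim0 (fun x => x + x - (u + x ** x)) 4) => // [n|e e0].
    set s := sqrt_iter n.
    have -> : c + c - (u + c ** c) - (s + s - (u + s ** s)) =
        (c - s) + (c - s) - (c ** c - s ** s) by linear_combination R[i].
    have := nmB (c - s + (c - s)) (c ** c - s ** s).
    have := nmD (c - s) (c - s); have := nm_sqr_sub c s.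
    by have := nm_ge0 (c - s); have := s1 n; rewrite -/s; nra.
  have [|N gN] := @sqrt_majorant_cauchy (e / 2); first by rewrite divr_gt0.
  exists N => n Nn; set s := sqrt_iter n.
  have -> : s + s - (u + s ** s) = - ((sqrt_iter n.+1 - s) + (sqrt_iter n.+1 - s)).
    have <- : sqrt_iter n.+1 + sqrt_iter n.+1 = u + s ** s.
      by rewrite /= -scalerDl two_half scale1r.
    by linear_combination R[i].
  have := sqrt_iter_step n; have := gN n.+1 n; rewrite Nn leqnSn -/s => /(_ isT).
  by have := nmD (sqrt_iter n.+1 - s) (sqrt_iter n.+1 - s); rewrite nmN; lra.
- move=> z zu; apply/subr0_eq.
  apply: (lim0 (fun x => z ** x - x ** z) (nm z + nm z)) => [|n|e e0].
  + by rewrite addr_ge0// nm_ge0.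
  + rewrite (sqrt_iter_comm zu) subrr subr0.
    set s := sqrt_iter n.
    have -> : z ** c - c ** z = z ** (c - s) - (c - s) ** z.
      rewrite cmulBr cmulBl -[z ** s]/(z ** sqrt_iter n) (sqrt_iter_comm zu) -/s.
      by rewrite opprB addrA subrK.
    rewrite (le_trans (nmB _ _))// mulrDl lerD ?nmM//.
    by rewrite mulrC nmM.
  + by exists 0%N => n _; rewrite (sqrt_iter_comm zu) subrr nm0 ltW.
Qed.


(** By commutation [w = x + i y] satisfies [w^* w = x^2 + y^2], and [x] is the real part of [w], so
    [|x| <= |w|]. This replaces monotonicity of the norm on positive elements. *)
Lemma nm_sqr_le_commuting (x y : A) : star x = x -> star y = y ->
  x ** y = y ** x -> nm x ^+ 2 <= nm (x ** x + y ** y).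
Proof.
move=> xs ys xy; pose w := x + 'i *: y.
have ws : star w = x - 'i *: y.
  by rewrite starD starZ xs ys conjCi scaleNr.
have <- : star w ** w = x ** x + y ** y.
  rewrite ws /w cmulBl !cmulDr !cmulZr !cmulZl scalerA -expr2 sqrCi xy.
  by linear_combination R[i].
rewrite nm_star_mul ler_pXn2r// ?nnegrE ?nm_ge0//.
have -> : x = half *: (w + star w).
  by rewrite ws /w addrACA subrr addr0 scalerDr -scalerDl two_half scale1r.
by rewrite nm_half; have := nmD w (star w); rewrite nm_star; lra.
Qed.

End SquareRoot.

Section HomContraction.
Variables (R : realType) (A B : cstarAlgType R) (f : A -> B).
Hypothesis f_hom : star_hom f.

Lemma star_homD x y : f (x + y) = f x + f y.
Proof. by have := star_hom_linear f_hom 1 x y; rewrite !scale1r. Qed.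
Lemma star_hom0 : f 0 = 0.
Proof. by apply: (addrI (f 0)); rewrite -star_homD !addr0. Qed.
Lemma star_homZ k x : f (k *: x) = k *: f x.
Proof. by have := star_hom_linear f_hom k x 0; rewrite star_hom0 !addr0. Qed.
Lemma star_homB x y : f (x - y) = f x - f y.
Proof. by rewrite -scaleN1r star_homD star_homZ scaleN1r. Qed.
Lemma star_hom_sum (I : Type) (r : seq I) (Q : pred I) (F : I -> A) :
  f (\sum_(i <- r | Q i) F i) = \sum_(i <- r | Q i) f (F i).
Proof. exact: (big_morph f star_homD star_hom0). Qed.

(* With [c = 1 - sqrt (1 - a^2)], the image [x = f a] satisfies
   [x^2 + (1 - f c)^2 = 1]; multiplying by [x^2] keeps this in [B]. *)
Let nm_hom_sa a : star a = a -> nm a <= 1 -> nm (f a) <= 1.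
Proof.
move=> sa a1; have [| |c [cs c1 ca cc]] := @cstar_sqrt R A (a ** a).
- by rewrite starM sa.
- by rewrite nm_sa_sqr// exprn_ile1 ?nm_ge0.
have ac : a ** c = c ** a by apply: cc; rewrite cmulA.
pose x := f a; pose y := f c.
have xs : star x = x by rewrite -(star_hom_star f_hom) sa.
have ys : star y = y by rewrite -(star_hom_star f_hom) cs.
have xy : x ** y = y ** x by rewrite -!(star_hom_cmul f_hom) ac.
have xyE : x ** x = y + y - y ** y.
  by rewrite -!(star_hom_cmul f_hom) -star_homD -star_homB ca addrK.
pose z := x - y ** x.
have zs : star z = z by rewrite starB starM xs ys xy.
have xz : x ** x ** z = z ** (x ** x).
  have xxy : x ** x ** y = y ** x ** x by rewrite -cmulA xy cmulA xy.
  by rewrite /z cmulBr cmulBl !cmulA xxy.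
have := @nm_sqr_le_commuting R B (x ** x) z _ zs xz.
rewrite starM xs => /(_ erefl).
have -> : x ** x ** (x ** x) + z ** z = x ** x.
  have zx : z = x - x ** y by rewrite /z xy.
  rewrite {1}zx /z !cmulBl !cmulBr.
  have -> : x ** (y ** x) = x ** y ** x by rewrite cmulA.
  have -> : x ** y ** (y ** x) = x ** (y ** y) ** x by rewrite !cmulA.
  have -> : x ** x ** (x ** x) = x ** (x ** x) ** x by rewrite !cmulA.
  rewrite {1}xyE cmulBr cmulBl cmulDr cmulDl.
  by linear_combination R[i].
(* The identity [x^4 + z^2 = x^2] has given [|x^2|^2 <= |x^2|], that is [|x|^4 <= |x|^2], which
   excludes [|x| > 1]. *)
rewrite nm_sa_sqr// -exprM => x42; rewrite leNgt; apply/negP => x1.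
by move: x42; rewrite ler_eXn2l.
Qed.

Lemma nm_star_hom a : nm (f a) <= nm a.
Proof.
suff h b : star b = b -> nm (f b) <= nm b.
  rewrite -(@ler_pXn2r _ 2)// ?nnegrE ?nm_ge0// -!nm_star_mul.
  by rewrite -(star_hom_star f_hom) -(star_hom_cmul f_hom) h// starM starK.
move=> sb; have [b0|b0] := eqVneq (nm b) 0.
  by rewrite (nm_eq0 b0) star_hom0 nm0 nm0.
have bp : 0 < nm b by rewrite lt_neqAle eq_sym b0 nm_ge0.
have := @nm_hom_sa (((nm b)^-1)%:C *: b); rewrite starZr sb => /(_ erefl).
rewrite star_homZ !nmZr normfV ger0_norm ?nm_ge0// mulVf// lexx => /(_ isT).
by rewrite mulrC ler_pdivrMr// mul1r.
Qed.

Lemma nm_star_homB a b : nm (f a - f b) <= nm (a - b).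
Proof. by rewrite -star_homB nm_star_hom. Qed.

End HomContraction.

Lemma star_hom_comp (R : realType) (B1 B2 B3 : cstarAlgType R) (f : B2 -> B3) (g : B1 -> B2) :
  star_hom f -> star_hom g -> star_hom (f \o g).
Proof.
move=> fh gh; split=> [k x y|x y|x] /=.
- by rewrite (star_hom_linear gh) (star_hom_linear fh).
- by rewrite (star_hom_cmul gh) (star_hom_cmul fh).
- by rewrite (star_hom_star gh) (star_hom_star fh).
Qed.

(** * Positive elements *)

Section Positivity.
Variables (R : realType) (A : unitalCstarAlgType R).
Implicit Types (a b h k x y z : A) (s t : R).

Local Notation "t %:1" := (real_complex R t *: (cone : A))
  (at level 1, format "t %:1").

Lemma star_cone : star (cone : A) = cone.
Proof. by rewrite -[LHS]cmulx1 -{2}[cone]starK -starM cmulx1 starK. Qed.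

Lemma star_scalar t : star t%:1 = t%:1.
Proof. by rewrite starZr star_cone. Qed.

Lemma scalar_cmul t z : t%:1 ** z = t%:C *: z.
Proof. by rewrite cmulZl cmul1x. Qed.

Lemma cmul_scalar t z : z ** t%:1 = t%:C *: z.
Proof. by rewrite cmulZr cmulx1. Qed.

Lemma scalar_comm t z : z ** t%:1 = t%:1 ** z.
Proof. by rewrite cmulZr cmulZl cmul1x cmulx1. Qed.

Lemma nm_cone : nm (cone : A) = 1.
Proof.
have n0 : nm (cone : A) != 0 by apply: contra_neq (@cone_neq0 R A); exact: nm_eq0.
by apply: (mulIf n0); rewrite -expr2 -nm_star_mul star_cone cmul1x mul1r.
Qed.

Lemma nm_scalar t : nm t%:1 = `|t|.
Proof. by rewrite nmZr nm_cone mulr1. Qed.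

Lemma scalarD s t : (s + t)%:1 = s%:1 + t%:1.
Proof. by rewrite rmorphD scalerDl. Qed.

Lemma scalarB s t : (s - t)%:1 = s%:1 - t%:1.
Proof. by rewrite rmorphB scalerBl. Qed.

(** Squares of self-adjoint elements, the form that the root construction delivers. That every
    [a^* a] is of this form is the harder [positive_star_mul]. *)
Definition positive h : Prop := exists k, star k = k /\ h = k ** k.

Lemma positive_sa h : positive h -> star h = h.
Proof. by move=> [k [ks ->]]; rewrite starM ks. Qed.

(** For [t > 0], [d = sqrt t (1 - c)], where [c] comes from [cstar_sqrt] at [b / t]. The norm clause
    records [|c| <= 1]; through [positive_nm] it makes such roots positive themselves. *)
Lemma scalar_sub_sqrt b t : star b = b -> nm b <= t -> exists d,
  [/\ star d = d, t%:1 - b = d ** d, nm ((Num.sqrt t)%:1 - d) <= Num.sqrt t &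
      forall z, z ** b = b ** z -> z ** d = d ** z].
Proof.
move=> bs bt; have [t0|t0] := leP t 0.
  have tE : t = 0 by apply/le_anti; rewrite t0 (le_trans _ bt)// nm_ge0.
  have b0 : b = 0 by apply/nm_eq0/le_anti; rewrite nm_ge0 -tE bt.
  exists 0; rewrite tE b0 sqrtr0 star0 scale0r !subr0 cmul0r nm0.
  by split=> // z _; rewrite cmul0r cmulr0.
have [| |c [cs c1 ce cz]] := @cstar_sqrt R A ((t^-1)%:C *: b).
- by rewrite starZr bs.
- by rewrite nmZr normfV (gtr0_norm t0) mulrC ler_pdivrMr// mul1r.
exists ((Num.sqrt t)%:C *: (cone - c)); split.
- by rewrite starZr starB star_cone cs.
- have tb : t%:C *: ((t^-1)%:C *: b) = b.
    by rewrite scalerA -rmorphM mulfV ?gt_eqF// rmorph1 scale1r.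
  rewrite cmulZl cmulZr scalerA -rmorphM -expr2 sqr_sqrtr ?ltW//.
  rewrite cmulBl !cmulBr cmul1x !cmulx1 cmul1x -{1}tb -scalerBr; congr (_ *: _).
  have -> : (t^-1)%:C *: b = c + c - c ** c by rewrite ce addrK.
  by linear_combination R[i].
- rewrite -scalerBr opprB addrC subrK nmZr ger0_norm ?sqrtr_ge0//.
  by rewrite ler_piMr ?sqrtr_ge0.
- move=> z zb; rewrite cmulZl cmulZr cmulBl cmulBr cmul1x cmulx1 cz//.
  by rewrite cmulZl cmulZr zb.
Qed.

Lemma positive_scalar_sub b t : star b = b -> nm b <= t -> positive (t%:1 - b).
Proof. by move=> bs /(scalar_sub_sqrt bs)[d [ds de _ _]]; exists d. Qed.

(** With [d^2 = t - h] and [h = k^2] commuting, [d^2 + k^2 = t] gives [|d|^2 <= t]. Together with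
    [positive_nm] this turns positivity into the norm condition [|t - h| <= t], from which stability
    under sums is the triangle inequality. *)
Lemma nm_scalar_sub h t : positive h -> nm h <= t -> nm (t%:1 - h) <= t.
Proof.
move=> hp ht; have [d [ds de _ dz]] := scalar_sub_sqrt (positive_sa hp) ht.
have [k [ks hk]] := hp.
have kd : k ** d = d ** k by apply: dz; rewrite hk cmulA.
have := nm_sqr_le_commuting ds ks (esym kd); rewrite -de -hk subrK nm_scalar.
by rewrite de nm_sa_sqr// ger0_norm// (le_trans _ ht)// nm_ge0.
Qed.

Lemma nm_scalar_sub_sqrt h t : star h = h -> nm (t%:1 - h) <= t -> exists k,
  [/\ star k = k, h = k ** k, nm ((Num.sqrt t)%:1 - k) <= Num.sqrt t &
      forall z, z ** h = h ** z -> z ** k = k ** z].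
Proof.
move=> hs ht; have [|k [ks ke kt kz]] := scalar_sub_sqrt _ ht.
  by rewrite starB hs star_scalar.
exists k; split=> //; first by rewrite -ke opprB addrC subrK.
by move=> z zh; apply: kz; rewrite cmulBl cmulBr scalar_comm zh.
Qed.

Lemma positive_nm h t : star h = h -> nm (t%:1 - h) <= t -> positive h.
Proof. by move=> hs /(nm_scalar_sub_sqrt hs)[k [ks hk _ _]]; exists k. Qed.

Lemma positive_sqrt h : positive h -> exists k,
  [/\ positive k, h = k ** k & forall z, z ** h = h ** z -> z ** k = k ** z].
Proof.
move=> hp; have := nm_scalar_sub hp (lexx _).
move=> /(nm_scalar_sub_sqrt (positive_sa hp))[k [ks hk kt kz]].
by exists k; split=> //; exact: positive_nm ks kt.
Qed.

Lemma positiveD x y : positive x -> positive y -> positive (x + y).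
Proof.
move=> xp yp; apply: (@positive_nm _ (nm x + nm y)).
  by rewrite starD !positive_sa.
rewrite scalarD opprD addrACA (le_trans (nmD _ _))// lerD// nm_scalar_sub//.
Qed.

Lemma positiveZ t x : 0 <= t -> positive x -> positive (t%:C *: x).
Proof.
move=> t0 [k [ks ->]]; exists ((Num.sqrt t)%:C *: k); rewrite starZr ks.
by rewrite cmulZl cmulZr scalerA -rmorphM -expr2 sqr_sqrtr.
Qed.

Lemma positive_scalar t : 0 <= t -> positive t%:1.
Proof. by move=> t0; apply: positiveZ => //; exists cone; rewrite star_cone cmul1x. Qed.

(** The roots [k] of [t - b] and [l] of [t + b] commute with each other and with [b], and
    [b^2 + (k l)^2 = t^2]. *)
Lemma nm_le_positive b t : 0 <= t -> positive (t%:1 - b) -> positive (t%:1 + b) ->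
  nm b <= t.
Proof.
move=> t0 p1 p2.
have bs : star b = b.
  by have := positive_sa p2; rewrite starD star_scalar => /addrI.
have [k [/positive_sa ks ke kz]] := positive_sqrt p1.
have [l [/positive_sa ls le lz]] := positive_sqrt p2.
have bk : b ** k = k ** b by apply: kz; rewrite cmulBl cmulBr scalar_comm.
have bl : b ** l = l ** b by apply: lz; rewrite cmulDl cmulDr scalar_comm.
have kl : k ** l = l ** k by apply: lz; rewrite cmulDl cmulDr scalar_comm bk.
have kls : star (k ** l) = k ** l by rewrite starM ks ls kl.
have bkl : b ** (k ** l) = k ** l ** b by rewrite cmulA bk -cmulA bl cmulA.
have := nm_sqr_le_commuting bs kls bkl.
have -> : k ** l ** (k ** l) = (t%:1 - b) ** (t%:1 + b).
  by rewrite ke le -!cmulA; congr (k ** _); rewrite !cmulA kl.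
rewrite cmulBl !cmulDr !cmul_scalar scalar_cmul scalerA -rmorphM /=.
have -> : b ** b + ((t * t)%:1 + t%:C *: b - (t%:C *: b + b ** b)) = (t * t)%:1.
  by linear_combination R[i].
by rewrite nm_scalar -expr2 normrX (ger0_norm t0) ler_pXn2r// nnegrE nm_ge0.
Qed.

(* Fukamiya-Kaplansky argument: if [x^* x <= 0 <= x x^*] then [x = 0], since
   [x^* (n - x x^* ) x] is bounded by [n^2], where [n = |x|^2]. *)
Lemma star_mul_neg_eq0 x :
  positive (- (star x ** x)) -> positive (x ** star x) -> x = 0.
Proof.
move=> yp qp; set y := - (star x ** x) in yp; set q := x ** star x in qp.
pose n := nm x ^+ 2; have n0 : 0 <= n by rewrite sqr_ge0.
have ny : nm y = n by rewrite /y nmN nm_star_mul.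
have nq : nm q = n by rewrite /q -{1}(starK x) nm_star_mul nm_star.
have ysa := positive_sa yp.
have zE : star x ** (n%:1 - q) ** x = - (n%:C *: y + y ** y).
  rewrite cmulBr cmulBl cmul_scalar cmulZl.
  have -> : star x ** q ** x = y ** y by rewrite /y cmulNl cmulNr opprK !cmulA.
  by rewrite /y scalerN opprD opprK.
have nz : nm (n%:C *: y + y ** y) <= n ^+ 2.
  rewrite -nmN -zE (le_trans (nmM _ _))// (@le_trans _ _ (nm x * n * nm x))//.
    rewrite ler_wpM2r ?nm_ge0// (le_trans (nmM _ _))// nm_star.
    by rewrite ler_wpM2l ?nm_ge0// nm_scalar_sub// nq.
  by rewrite mulrAC -expr2 expr2.
have nzp : positive ((n ^+ 2)%:1 - (n%:C *: y + y ** y)).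
  by apply: positive_scalar_sub => //; rewrite starD starZr starM ysa.
have nysqp : positive ((n%:1 - y) ** (n%:1 - y)).
  by exists (n%:1 - y); rewrite starB star_scalar ysa.
have n_eq0 : n = 0 -> x = 0.
  by move=> nx0; apply/nm_eq0/eqP; rewrite -sqrf_eq0 -/n nx0.
have [/n_eq0//|n0'] := eqVneq n 0.
clearbody n.
have np : 0 < n by rewrite lt_neqAle eq_sym n0'.
(* Adding [n^2 - n y - y^2 >= 0] and [(n - y)^2 >= 0] cancels [y^2] and leaves [3 n y <= 2 n^2],
   against [|y| = n]. *)
have yle : positive ((2 / 3 * n)%:1 - y).
  have -> : (2 / 3 * n)%:1 - y = ((3 * n)^-1)%:C *:
      (((n ^+ 2)%:1 - (n%:C *: y + y ** y)) + (n%:1 - y) ** (n%:1 - y)).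
    rewrite cmulBl !cmulBr !cmul_scalar scalar_cmul.
    have -> : (n ^+ 2)%:1 - (n%:C *: y + y ** y) +
        (n%:C *: n%:1 - n%:C *: y - (n%:C *: y - y ** y)) =
        (2 * n ^+ 2)%:1 - (3 * n)%:C *: y.
      by rewrite !rmorphM ?rmorphXn ?rmorph_nat; linear_combination R[i].
    rewrite scalerBr !scalerA -!rmorphM /= mulVf ?mulf_neq0 ?pnatr_eq0//.
    rewrite rmorph1 scale1r; congr ((_ %:C *: _) - _); field.
    exact: n0'.
  by apply: positiveZ; [rewrite invr_ge0 mulr_ge0 |exact: positiveD].
have : nm y <= 2 / 3 * n.
  apply: nm_le_positive => //; first by rewrite mulr_ge0// divr_ge0.
  by apply: positiveD => //; apply: positive_scalar; rewrite mulr_ge0// divr_ge0.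
by rewrite ny => n23; exfalso; clear -np n23; lra.
Qed.

(** With [p] the positive root of [h^2], [m = p - h] is twice the negative part of [h], and
    [h m = - p m]. Then [x = a m] has [x^* x = - (q m)^2] with [q^2 = p], while [x x^* + x^* x] is
    half a sum of two squares, so [x x^*] is positive and [star_mul_neg_eq0] gives [x = 0]. Hence
    [h m = p m = 0], so [m^2 = 0] and [h = p]. *)
Lemma positive_star_mul a : positive (star a ** a).
Proof.
set h := star a ** a; have hs : star h = h by rewrite starM starK.
have [p [pp pe pz]] : exists p, [/\ positive p, h ** h = p ** p &
    forall z, z ** (h ** h) = h ** h ** z -> z ** p = p ** z].
  by apply: positive_sqrt; exists h.
have ps := positive_sa pp.
have hp : h ** p = p ** h by apply: pz; rewrite cmulA.
pose m := p - h; have ms : star m = m by rewrite starB ps hs.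
have hm : h ** m = - (p ** m) by rewrite !cmulBr pe hp opprB.
have pm : p ** m = m ** p by rewrite cmulBr cmulBl hp.
have [q [/positive_sa qs qe qz]] := positive_sqrt pp.
have qm : q ** m = m ** q by rewrite qz// -pm.
pose x := a ** m.
have xx : star x ** x = - ((q ** m) ** (q ** m)).
  rewrite {1}qm starM ms !cmulA -[m ** star a ** a]cmulA -/h.
  by rewrite -[m ** h ** m]cmulA hm cmulNr qe !cmulA.
have x0 : x = 0.
  apply: star_mul_neg_eq0; first by rewrite xx opprK; exists (q ** m);
    rewrite starM qs ms qm.
  have -> : x ** star x = (x ** star x + star x ** x) + (q ** m) ** (q ** m).
    by rewrite xx subrK.
  apply: positiveD; last by exists (q ** m); rewrite starM qs ms qm.
  pose u := x + star x; pose v := 'i *: (x - star x).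
  have -> : x ** star x + star x ** x = (2^-1)%:C *: (u ** u + v ** v).
    rewrite /u /v cmulZl cmulZr scalerA -expr2 sqrCi.
    rewrite !cmulDl !cmulDr !cmulNl !cmulNr.
    have -> : (2^-1)%:C = 2^-1 :> R[i] by rewrite fmorphV rmorph_nat.
    by linear_combination R[i].
  apply: positiveZ; first by rewrite invr_ge0.
  apply: positiveD; first by exists u; rewrite /u starD starK addrC.
  by exists v; rewrite /v starZ starB starK conjCi scaleNr -scalerN opprB.
have m0 : p ** m = 0.
  apply/oppr_inj; rewrite -hm oppr0.
  by rewrite -[h]/(star a ** a) -cmulA -/x x0 cmulr0.
suff -> : h = p by [].
apply/esym/subr0_eq/star_mul_eq0.
by rewrite -/m ms {1}/m cmulBl m0 hm m0 oppr0 subr0.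
Qed.

End Positivity.

(** * Existence of states *)

Section TotalCone.
Variables (R : realType) (A : unitalCstarAlgType R) (M : set A).
Implicit Types (x y z : A) (s t : R).

Local Notation "t %:1" := (real_complex R t *: (cone : A))
  (at level 1, format "t %:1").

Hypotheses (MD : forall x y, M x -> M y -> M (x + y))
  (MZ : forall t x, 0 <= t -> M x -> M (t%:C *: x))
  (Mpos : forall x, positive x -> M x)
  (Mskew : forall x, star x = - x -> M x)
  (MN1 : ~ M (- cone))
  (Mtotal : forall x, M x \/ M (- x)).

(** The functional defined by the order of the cone. As [M] contains the skew elements, it ignores
    imaginary parts and will be the real part of a state. *)
Definition cone_sup x : R := sup [set t | M (x - t%:1)].

Let M_neg_scalar t : M t%:1 -> 0 <= t.
Proof.
move=> Mt; rewrite leNgt; apply/negP => t0; apply: MN1.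
have -> : - cone = (- t^-1)%:C *: (t%:1 : A).
  rewrite scalerA -rmorphM mulNr mulVf ?lt_eqF//.
  by rewrite rmorphN rmorph1 scaleN1r.
by apply: MZ => //; rewrite oppr_ge0 invr_le0 ltW.
Qed.

Let M_le x s t : M (x - s%:1) -> t <= s -> M (x - t%:1).
Proof.
move=> Ms ts; rewrite -(subrKA s%:1) -scalarB.
by apply: MD => //; apply/Mpos/positive_scalar; rewrite subr_ge0.
Qed.

Let M_addnm x : M (x + (nm x)%:1).
Proof.
pose h := (2^-1)%:C *: (x + star x); pose k := (2^-1)%:C *: (x - star x).
have twoC : (2^-1)%:C = 2^-1 :> R[i] by rewrite fmorphV rmorph_nat.
have -> : x + (nm x)%:1 = ((nm x)%:1 - (- h)) + k.
  by rewrite /h /k twoC; linear_combination R[i].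
apply: MD; last by apply: Mskew; rewrite /k starZr starB starK -scalerN opprB.
apply/Mpos/positive_scalar_sub; first by rewrite starN starZr starD starK addrC.
rewrite nmN nmZr ger0_norm ?invr_ge0// mulrC ler_pdivrMr// mulr_natr mulr2n.
by rewrite (le_trans (nmD _ _))// nm_star.
Qed.

Let has_sup_cone x : has_sup [set t | M (x - t%:1)].
Proof.
split; first by exists (- nm x); rewrite /= rmorphN scaleNr opprK; exact: M_addnm.
exists (nm x) => t /= Mt; rewrite -subr_ge0; apply: M_neg_scalar.
rewrite scalarB; have -> : (nm x)%:1 - t%:1 = (- x + (nm (- x))%:1) + (x - t%:1).
  by rewrite nmN; linear_combination R[i].
exact: MD.
Qed.

Let cone_sup_ge x t : M (x - t%:1) -> t <= cone_sup x.
Proof. by move=> Mt; apply: ub_le_sup => //; case: (has_sup_cone x). Qed.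

Let cone_sup_le x t : M (t%:1 - x) -> cone_sup x <= t.
Proof.
move=> Mt; apply: ge_sup; first by case: (has_sup_cone x).
move=> s /= Ms; rewrite -subr_ge0; apply: M_neg_scalar.
by rewrite scalarB -(subrKA x); exact: MD.
Qed.

Let cone_sup_lt x t : t < cone_sup x -> M (x - t%:1).
Proof.
move=> /sup_gt[|s /= Ms /ltW ts]; first by case: (has_sup_cone x).
exact: M_le ts.
Qed.

Let cone_sup_gt x t : cone_sup x < t -> M (t%:1 - x).
Proof.
move=> xt; have [/cone_sup_ge|] := Mtotal (x - t%:1); last by rewrite opprB.
by rewrite leNgt xt.
Qed.

(** Below the supremum [x - t] lies in [M]; above it totality puts [t - x] in [M]. This symmetry
    upgrades the superadditivity coming from [MD] to additivity. *)
Lemma cone_supN x : cone_sup (- x) = - cone_sup x.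
Proof.
apply/le_anti/andP; split; apply/ler_addgt0Pr => e e0.
  rewrite addrC -opprB; apply: cone_sup_le.
  by rewrite opprK rmorphN scaleNr addrC; apply: cone_sup_lt; rewrite ltrBlDr ltrDl.
rewrite -lerBlDr -opprD; apply: cone_sup_ge.
by rewrite rmorphN scaleNr opprK addrC; apply: cone_sup_gt; rewrite ltrDl.
Qed.

Lemma cone_supD x y : cone_sup (x + y) = cone_sup x + cone_sup y.
Proof.
have supD u v : cone_sup u + cone_sup v <= cone_sup (u + v).
  apply/ler_addgt0Pr => e e0; rewrite -lerBlDr [e]splitr opprD addrACA.
  apply: cone_sup_ge; rewrite scalarD opprD addrACA.
  by apply: MD; apply: cone_sup_lt; rewrite ltrBlDr ltrDl divr_gt0.
apply/le_anti; rewrite supD andbT.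
by have := supD (- x) (- y); rewrite -opprD !cone_supN -opprD lerN2.
Qed.

Lemma cone_supZ t x : cone_sup (t%:C *: x) = t * cone_sup x.
Proof.
have le0 s u : 0 < s -> s * cone_sup u <= cone_sup (s%:C *: u).
  move=> s0; apply/ler_addgt0Pr => e e0; rewrite -lerBlDr.
  have -> : s * cone_sup u - e = s * (cone_sup u - e / s).
    by rewrite mulrBr mulrCA mulfV ?gt_eqF// mulr1.
  apply: cone_sup_ge; rewrite rmorphM -scalerA -scalerBr; apply: (MZ (ltW s0)).
  by apply: cone_sup_lt; rewrite ltrBlDr ltrDl divr_gt0.
have pos s : 0 < s -> cone_sup (s%:C *: x) = s * cone_sup x.
  move=> s0; apply/le_anti; rewrite le0// andbT -ler_pdivrMl//.
  have := le0 s^-1 (s%:C *: x); rewrite scalerA -rmorphM mulVf ?gt_eqF//.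
  by rewrite scale1r invr_gt0; exact.
have [t0|t0|->] := ltgtP t 0; last 2 first.
- exact: pos.
- by apply: (addrI (cone_sup 0)); rewrite mul0r scale0r -cone_supD !addr0.
rewrite -[t]opprK rmorphN scaleNr cone_supN pos ?oppr_gt0//.
by rewrite !mulNr.
Qed.

(** The complex-linear functional with real part [cone_sup], by the formula
    [f x = Re (f x) - i Re (f (i x))]. *)
Definition cone_state : functional A :=
  fun x => Complex (cone_sup x) (- cone_sup ('i *: x)).

Lemma cone_state_is_state : is_state cone_state.
Proof.
have skew0 x : star x = - x -> cone_sup x = 0.
  move=> xs; apply/le_anti/andP; split.
    apply: cone_sup_le; rewrite scale0r sub0r; apply: Mskew.
    by rewrite starN xs.
  by apply: cone_sup_ge; rewrite scale0r subr0; exact: Mskew.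
have i_sa x : star x = x -> cone_sup ('i *: x) = 0.
  by move=> xs; apply: skew0; rewrite starZ xs conjCi scaleNr.
split.
- move=> k x y; rewrite /cone_state.
  rewrite scalerDr !cone_supD.
  case: k => a b.
  have kE : (a +i* b)%C = a%:C + b%:C * 'i :> R[i] by rewrite [LHS]complexE mulrC.
  have -> : cone_sup ((a +i* b)%C *: x) = a * cone_sup x + b * cone_sup ('i *: x).
    by rewrite kE scalerDl -scalerA cone_supD !cone_supZ.
  have -> : cone_sup ('i *: ((a +i* b)%C *: x)) =
      a * cone_sup ('i *: x) - b * cone_sup x.
    rewrite scalerA kE mulrDr ['i * (_ * _)]mulrC -mulrA -expr2 sqrCi mulrN1.
    by rewrite mulrC scalerDl -scalerA scaleNr cone_supD cone_supN !cone_supZ.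
  apply/eqP; rewrite eq_complex /=; apply/andP; split; apply/eqP; ring.
- move=> a; rewrite /cone_state i_sa ?starM ?starK// oppr0 ler0c.
  by apply: cone_sup_ge; rewrite scale0r subr0; apply/Mpos/positive_star_mul.
- rewrite /cone_state i_sa ?star_cone// oppr0.
  suff -> : cone_sup cone = 1 by [].
  apply/le_anti/andP; split.
    by apply: cone_sup_le; rewrite scale1r subrr; apply: Mskew; rewrite star0 oppr0.
  by apply: cone_sup_ge; rewrite scale1r subrr; apply: Mskew; rewrite star0 oppr0.
Qed.

Lemma cone_state_ge x t : M (x - t%:1) -> t <= complex.Re (cone_state x).
Proof. exact: cone_sup_ge. Qed.

End TotalCone.

Section StateExistence.
Variables (R : realType) (A : unitalCstarAlgType R).
Implicit Types (x y z : A) (s t : R).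

Local Notation "t %:1" := (real_complex R t *: (cone : A))
  (at level 1, format "t %:1").

Lemma not_positive_neg1 : ~ positive (- cone : A).
Proof.
move=> n1; suff : nm (cone : A) <= 0 by rewrite nm_cone ler10.
apply: nm_le_positive => //; rewrite scale0r ?sub0r ?add0r//.
by rewrite -[cone]scale1r; exact: positive_scalar.
Qed.

(** A Hahn-Banach separation by cones: the cone [M0] spanned by the positive elements, the skew ones
    and [b - s] avoids [-1], and a maximal cone avoiding [-1] is total, hence defines a state that
    is nonnegative on [b - s]. *)
Lemma exists_state_ge b s : star b = b -> ~ positive (s%:1 - b) ->
  exists mu : functional A, is_state mu /\ s <= complex.Re (mu b).
Proof.
move=> bs nb; pose g := b - s%:1; have gs : star g = g by rewrite starB star_scalar bs.
pose M0 := [set x | exists p k (r : R),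
  [/\ positive p, star k = - k, 0 <= r & x = p + k + r%:C *: g]].
pose closed_cone (M : set A) := (forall x y, M x -> M y -> M (x + y)) /\
  (forall t x, 0 <= t -> M x -> M (t%:C *: x)).
have pos0 : positive (0 : A) by exists 0; rewrite star0 cmul0r.
have M00 : M0 0.
  by exists 0, 0, 0; rewrite star0 oppr0 scale0r !addr0.
have M0cone : closed_cone M0.
  split=> [x y [p [k [r [pp ks r0 ->]]]] [p' [k' [r' [pp' ks' r0' ->]]]]|].
    exists (p + p'), (k + k'), (r + r'); split=> //; first exact: positiveD.
    - by rewrite starD ks ks' opprD.
    - exact: addr_ge0.
    - by rewrite rmorphD; linear_combination R[i].
  move=> t x t0 [p [k [r [pp ks r0 ->]]]].
  exists (t%:C *: p), (t%:C *: k), (t * r); split=> //; first exact: positiveZ.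
  - by rewrite starZr ks scalerN.
  - exact: mulr_ge0.
  - by rewrite rmorphM; linear_combination R[i].
(* If [-1 = p + k + r g], comparison with adjoints kills the skew [k]. Then [s - b = (1 + p) / r]
   would be positive or, when [r = 0], [-1] would be. *)
have M0N1 : ~ M0 (- cone).
  move=> [p [k [r [pp ks r0 e]]]].
  have k0 : k = 0.
    have := congr1 star e; rewrite starN star_cone !starD starZr ks gs.
    rewrite (positive_sa pp) e => /addIr/addrI kN.
    have : k + k = 0 by rewrite [X in X + _]kN addNr.
    rewrite -mulr2n => /eqP; rewrite -scaler_nat scaler_eq0 pnatr_eq0/=.
    by move/eqP.
  have [r00|rn0] := eqVneq r 0.
    have pE : p = - cone by rewrite e k0 r00 scale0r !addr0.
    by case: not_positive_neg1; rewrite -pE.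
  have rp : 0 < r by rewrite lt_neqAle eq_sym rn0.
  apply: nb; have -> : s%:1 - b = (r^-1)%:C *: (cone + p).
    have rg : r%:C *: g = - (cone + p).
      transitivity (p + k + r%:C *: g - p).
        by rewrite k0; linear_combination R[i].
      by rewrite -e opprD.
    have : - ((r^-1)%:C *: (r%:C *: g)) = (r^-1)%:C *: (cone + p).
      by rewrite rg scalerN opprK.
    by rewrite scalerA -rmorphM mulVf// scale1r opprB.
  apply: positiveZ; first by rewrite invr_ge0.
  by apply: positiveD => //; rewrite -[cone]scale1r; exact: positive_scalar.
(* The proviso [M !=set0] admits the union of the empty chain, which Zorn's lemma also requires to
   be good; maximality then rules out the empty set. *)
pose good (M : set A) := [/\ closed_cone M, ~ M (- cone) & M !=set0 -> M0 `<=` M].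
have [M [[[MD MZ] MN1 M0M] Mmax]] : exists M, good M /\ forall N, M `<` N -> ~ good N.
  apply: Zorn_bigcup => F Fgood Ftot; split.
  - split=> [x y [X FX Xx] [Y FY Yy]|t x t0 [X FX Xx]].
      have [XY|YX] := Ftot _ _ FX FY.
        by exists Y => //; case: (Fgood _ FY) => -[+ _] _ _; apply=> //; exact: XY.
      by exists X => //; case: (Fgood _ FX) => -[+ _] _ _; apply=> //; exact: YX.
    by exists X => //; case: (Fgood _ FX) => -[_ +] _ _; apply.
  - by move=> [X FX]; case: (Fgood _ FX).
  - move=> [x [X FX Xx]] y M0y; exists X => //.
    by case: (Fgood _ FX) => _ _; apply=> //; exists x.
have {}M0M : M0 `<=` M.
  apply: M0M; apply: contrapT => /nonemptyPn M_0.
  apply: (Mmax M0); last by split=> // _.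
  by rewrite M_0; split=> // /(_ _ M00).
have M1 : M cone.
  apply: M0M; exists cone, 0, 0; rewrite star0 oppr0 scale0r !addr0; split=> //.
  by rewrite -[cone]scale1r; exact: positive_scalar.
have Mtotal x : M x \/ M (- x).
  have [Mx|Mx] := pselect (M x); [by left|right].
  (* The cone spanned by [M] and [x] is strictly larger, so by maximality it contains
     [-1 = m + t x], and [- x = (1 + m) / t] lies in [M]. *)
  pose N := [set y | exists m t, [/\ M m, 0 <= t & y = m + t%:C *: x]].
  have MN : M `<=` N by move=> y My; exists y, 0; rewrite scale0r addr0.
  have Nx : N x.
    exists 0, 1; rewrite add0r scale1r ler01; split=> //; exact: M0M.
  have [m [t [Mm t0 e]]] : N (- cone).
    apply: contrapT => NN1; apply: (Mmax N); first by split=> // /(_ _ Nx).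
    split=> //; last by move=> _; exact: subset_trans MN.
    split=> [y z [m [t [Mm t0 ->]]] [m' [t' [Mm' t0' ->]]]|r y r0 [m [t [Mm t0 ->]]]].
      exists (m + m'), (t + t'); split; [exact: MD|exact: addr_ge0|].
      by rewrite rmorphD; linear_combination R[i].
    exists (r%:C *: m), (r * t); split; [exact: MZ|exact: mulr_ge0|].
    by rewrite rmorphM; linear_combination R[i].
  have [t00|tn0] := eqVneq t 0.
    by case: MN1; rewrite e t00 scale0r addr0.
  have -> : - x = (t^-1)%:C *: (cone + m).
    have tx : t%:C *: x = - (cone + m).
      transitivity (m + t%:C *: x - m); first by linear_combination R[i].
      by rewrite -e opprD.
    have : - ((t^-1)%:C *: (t%:C *: x)) = (t^-1)%:C *: (cone + m).
      by rewrite tx scalerN opprK.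
    by rewrite scalerA -rmorphM mulVf// scale1r.
  by apply: MZ; [rewrite invr_ge0|exact: MD].
have Mpos x : positive x -> M x.
  move=> xp; apply: M0M; exists x, 0, 0.
  by rewrite star0 oppr0 scale0r !addr0.
have Mskew x : star x = - x -> M x.
  move=> xs; apply: M0M; exists 0, x, 0.
  by rewrite scale0r add0r addr0.
exists (cone_state M); split; first exact: cone_state_is_state.
apply: cone_state_ge => //; apply: M0M; exists 0, 0, 1.
by rewrite star0 oppr0 scale1r !add0r ler01.
Qed.

End StateExistence.

Lemma exists_state (R : realType) (A : unitalCstarAlgType R) :
  exists mu : functional A, is_state mu.
Proof.
have [||mu [mus _]] := @exists_state_ge R A 0 (- 1); [exact: star0| |by exists mu].
by rewrite rmorphN rmorph1 scaleN1r subr0; exact: not_positive_neg1.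
Qed.

Section States.
Variables (R : realType) (A : unitalCstarAlgType R).
Implicit Types (a b c : A) (e : R).

Local Notation "t %:1" := (real_complex R t *: (cone : A))
  (at level 1, format "t %:1").

Lemma sa_decomposition a : exists b c, [/\ star b = b, star c = c, a = 'i *: c + b,
  nm b <= nm a & nm c <= nm a].
Proof.
have twoC : (2^-1)%:C = 2^-1 :> R[i] by rewrite fmorphV rmorph_nat.
have ii : 'i * 'i = -1 :> R[i] by rewrite -expr2 sqrCi.
have i1 : Normc.normc ('i : R[i]) = 1 by rewrite /= expr0n add0r expr1n sqrtr1.
exists ((2^-1)%:C *: (a + star a)), ((2^-1)%:C *: ('i *: (star a - a))); split.
- by rewrite starZr starD starK addrC.
- by rewrite starZr starZ starB starK conjCi scaleNr -scalerN opprB.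
- rewrite twoC; have -> : 'i *: (2^-1 *: ('i *: (star a - a))) =
      2^-1 *: (a - star a).
    rewrite scalerA [_ / _]mulrC -scalerA; congr (_ *: _).
    by rewrite scalerA ii scaleN1r opprB.
  by linear_combination R[i].
- rewrite nmZr ger0_norm ?invr_ge0//.
  by have := nmD a (star a); rewrite nm_star; lra.
- rewrite nmZr ger0_norm ?invr_ge0// nmZ i1 mul1r.
  by have := nmB (star a) a; rewrite nm_star; lra.
Qed.

Section State.
Variable mu : functional A.
Hypothesis mus : is_state mu.

Lemma stateP (k : R[i]) a b : mu (k *: a + b) = k * mu a + mu b.
Proof. by case: mus => + _ _; exact. Qed.

Lemma state0 : mu 0 = 0.
Proof. by apply: (addrI (1 * mu 0)); rewrite -stateP scaler0 !addr0 mul1r. Qed.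

Lemma stateN a : mu (- a) = - mu a.
Proof. by rewrite -scaleN1r -[X in mu X]addr0 stateP state0 addr0 mulN1r. Qed.

Lemma state_sa_real b : star b = b ->
  mu b = (complex.Re (mu b))%:C.
Proof.
have [_ mupos mu1] := mus.
move=> bs; have [d [ds de _ _]] := scalar_sub_sqrt bs (lexx _).
have bE : b = (-1) *: (d ** d) + (nm b)%:1.
  by rewrite scaleN1r -de opprB subrK.
have dr : mu (d ** d) \is Num.real by rewrite ger0_real// -{1}ds mupos.
rewrite RRe_real// bE stateP -[(nm b)%:1]addr0 stateP state0 mu1 addr0 mulr1.
by rewrite rpredD ?rpredM// ?rpredN ?rpred1 ?complex_real.
Qed.

End State.

(** If [b - l <= 2 e] failed, some state would take a value at least [l + 2 e] at [b], while the
    oscillation allows at most [l + e]; likewise from below. The factor 2 leaves room for the weak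
    inequality in [exists_state_ge]. *)
Lemma nm_sub_scalar_sa b (nu : functional A) e : 0 < e -> star b = b ->
  is_state nu -> (forall mu : functional A, is_state mu ->
    `|complex.Re (mu b) - complex.Re (nu b)| <= e) ->
  nm (b - (complex.Re (nu b))%:1) <= 2 * e.
Proof.
move=> e0 bs nus osc; set l := complex.Re (nu b).
have e20 : 0 <= 2 * e by rewrite mulr_ge0// ltW.
apply: nm_le_positive => //; apply: contrapT => npos.
  have [|mu [mus]] := @exists_state_ge R A b (l + 2 * e) bs.
    by apply: contra_not npos; rewrite opprB addrA -scalarD addrC [2 * e + l]addrC addrC.
  have := osc _ mus; rewrite ler_norml -/l => /andP[_ h1] h2.
  by exfalso; clear -e0 h1 h2; lra.
have [| |mu [mus]] := @exists_state_ge R A (- b) (2 * e - l).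
- by rewrite starN bs.
- apply: contra_not npos; rewrite opprK scalarB.
  by rewrite -addrA [- _ + b]addrC.
rewrite (stateN mus) raddfN /= => h2.
have := osc _ mus; rewrite ler_norml -/l => /andP[h1 _].
by exfalso; clear -e0 h1 h2; lra.
Qed.

Lemma nm_sub_scalar a (nu : functional A) e : 0 < e -> is_state nu ->
  (forall mu : functional A, is_state mu -> Normc.normc (mu a - nu a) <= e) ->
  exists k : R[i], nm (a - k *: cone) <= 4 * e.
Proof.
move=> e0 nus osc.
have [b [c [bs cs abc _ _]]] := sa_decomposition a.
have muE (mu : functional A) : is_state mu ->
    mu a = Complex (complex.Re (mu b)) (complex.Re (mu c)).
  move=> mus; rewrite {1}abc (stateP mus) (state_sa_real mus bs).
  rewrite (state_sa_real mus cs) /=.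
  by apply/eqP; rewrite eq_complex /=; apply/andP; split; apply/eqP; ring.
have re_le (u v : R) : `|u| <= Normc.normc (Complex u v).
  by rewrite /= -sqrtr_sqr ler_sqrt ?addr_ge0 ?sqr_ge0// lerDl sqr_ge0.
have im_le (u v : R) : `|v| <= Normc.normc (Complex u v).
  by rewrite /= -sqrtr_sqr ler_sqrt ?addr_ge0 ?sqr_ge0// lerDr sqr_ge0.
have hb : nm (b - (complex.Re (nu b))%:1) <= 2 * e.
  apply: nm_sub_scalar_sa => // mu mus; have := osc _ mus.
  by rewrite !muE//; apply: le_trans; exact: re_le.
have hc : nm (c - (complex.Re (nu c))%:1) <= 2 * e.
  apply: nm_sub_scalar_sa => // mu mus; have := osc _ mus.
  by rewrite !muE//; apply: le_trans; exact: im_le.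
exists ('i * (complex.Re (nu c))%:C + (complex.Re (nu b))%:C).
have -> : a - ('i * (complex.Re (nu c))%:C + (complex.Re (nu b))%:C) *: cone =
    'i *: (c - (complex.Re (nu c))%:1) + (b - (complex.Re (nu b))%:1).
  by rewrite {1}abc; linear_combination R[i].
rewrite (le_trans (nmD _ _))// nmZ.
have -> : Normc.normc ('i : R[i]) = 1.
  by rewrite /= expr0n add0r expr1n sqrtr1.
by rewrite mul1r; move: hb hc; clear; lra.
Qed.

End States.

(** * Direct sums and edge maps *)

Section DirectSumBasics.
Variables (R : realType) (I : finType) (A : I -> unitalCstarAlgType R).

Let AA : cstarAlgType R := dsum (fun v => A v : cstarAlgType R).
Implicit Types (a b : AA) (v w : I).

Definition summand v (x : A v) : AA :=
  @fam_in R I (fun v => A v : lmodType R[i]) v x.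

Definition summand1 v : AA := summand (cone : A v).

Lemma dsumP a b : (forall v, a v = b v) -> a = b.
Proof. by move=> ab; apply: functional_extensionality_dep. Qed.

Lemma summand_same v (x : A v) : summand x v = x.
Proof. by rewrite /summand /fam_in dfwithin. Qed.

Lemma summand_other v (x : A v) w : v != w -> summand x w = 0.
Proof. by move=> vw; rewrite /summand /fam_in dfwithout. Qed.

Lemma summand0 v : summand (0 : A v) = 0.
Proof.
apply: dsumP => w; have [<-|vw] := eqVneq v w; first by rewrite summand_same.
by rewrite summand_other.
Qed.

Lemma summandP v (k : R[i]) (x y : A v) :
  summand (k *: x + y) = k *: summand x + summand y.
Proof.
apply: dsumP => w; rewrite famDE famZE.
have [<-|vw] := eqVneq v w; first by rewrite !summand_same.
by rewrite !summand_other// scaler0 addr0.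
Qed.

Lemma summandM v (x y : A v) : summand x ** summand y = summand (x ** y).
Proof.
apply: dsumP => w; rewrite [LHS]/(summand x w ** summand y w).
have [<-|vw] := eqVneq v w; first by rewrite !summand_same.
by rewrite !summand_other//; exact: (@cmul0r R (A w)).
Qed.

Lemma summand_star v (x : A v) : star (summand x) = summand (star x).
Proof.
apply: dsumP => w; rewrite [LHS]/(star (summand x w)).
have [<-|vw] := eqVneq v w; first by rewrite !summand_same.
by rewrite !summand_other//; exact: (@star0 R (A w)).
Qed.

Lemma summand_cmulr v (x : A v) a : summand x ** a = summand (x ** a v).
Proof.
apply: dsumP => w; rewrite [LHS]/(summand x w ** a w).
have [<-|vw] := eqVneq v w; first by rewrite !summand_same.
by rewrite !summand_other//; exact: (@cmul0r R (A w)).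
Qed.

Lemma summand1_cmul v a : summand1 v ** a = summand (a v).
Proof. by rewrite /summand1 summand_cmulr cmul1x. Qed.

Lemma dsum_sumE (J : Type) (r : seq J) (Q : pred J) (F : J -> AA) v :
  (\sum_(j <- r | Q j) F j) v = \sum_(j <- r | Q j) F j v.
Proof. by apply: (big_morph (fun a : AA => a v)). Qed.

Lemma sum_scalars_summand (k : I -> R[i]) v :
  (\sum_w k w *: summand1 w) v = k v *: cone.
Proof.
rewrite dsum_sumE (bigD1 v)//= famZE /summand1 summand_same big1 ?addr0// => w wv.
by rewrite famZE summand_other ?scaler0.
Qed.

Lemma nm_dsum_le a (t : R) : 0 <= t -> (forall v, nm (a v) <= t) -> nm a <= t.
Proof.
move=> t0 at_; rewrite -nm_le; apply/(@dsum_normP R I (fun v => A v) a t t0) => v.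
by rewrite nm_le.
Qed.

Lemma nm_summand_le a v : nm (a v) <= nm a.
Proof. by rewrite -nm_le nmE; exact: (@le_dsum_norm R I (fun v => A v)). Qed.

End DirectSumBasics.

Section EdgeMaps.
Variables (R : realType) (G : graph) (A : vertex G -> unitalCstarAlgType R).
Variable phi : forall e : edge G, A (src e) -> A (rng e).
Arguments phi : clear implicits.

Let AA : cstarAlgType R := dsum (fun v => A v : cstarAlgType R).
Implicit Types (a b : AA) (e : edge G) (v : vertex G).

Definition edge_map e a : AA := summand (phi e (a (src e))).

(** Letters act from first to last, the order in which iterated transfers unfold. Words need not be
    paths: for homomorphisms [phi e], the value is 0 when consecutive edges do not match. *)
Fixpoint word_map (w : seq (edge G)) a : AA :=
  if w is e :: w' then word_map w' (edge_map e a) else a.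

Lemma word_map_rcons w e a : word_map (rcons w e) a = edge_map e (word_map w a).
Proof. by elim: w a => //= f w IH a. Qed.

Hypothesis phi_hom : forall e, star_hom (phi e).

Lemma edge_map_hom e : star_hom (edge_map e).
Proof.
have ph := phi_hom e; split.
- by move=> k a b; rewrite -summandP -(star_hom_linear ph).
- by move=> a b; rewrite summandM -(star_hom_cmul ph).
- by move=> a; rewrite summand_star -(star_hom_star ph).
Qed.

Lemma word_map_hom w : star_hom (word_map w).
Proof.
elim: w => [|e w IH]; first by split.
exact: star_hom_comp IH (edge_map_hom e).
Qed.

Hypothesis phi_unital : forall e, phi e cone = cone.

Lemma edge_map1 e v :
  edge_map e (summand1 A v) = if src e == v then summand1 A (rng e) else 0.
Proof.
rewrite /edge_map /summand1; have [<-|vw] := eqVneq (src e) v.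
  by rewrite summand_same phi_unital.
by rewrite summand_other 1?eq_sym// (star_hom0 (phi_hom e)) summand0.
Qed.

Lemma pullback_state e (mu : functional (A (rng e))) :
  is_state mu -> is_state (pullback phi (e := e) mu).
Proof.
move=> [mulin mupos mu1]; split.
- by move=> k x y; rewrite /pullback (star_hom_linear (phi_hom e)) mulin.
- move=> x; rewrite /pullback (star_hom_cmul (phi_hom e)).
  by rewrite (star_hom_star (phi_hom e)) mupos.
- by rewrite /pullback phi_unital mu1.
Qed.

End EdgeMaps.

(** * Iterated edge maps are asymptotically scalar *)

Lemma exists_pow_le (R : realType) (c K e : R) : 0 < c < 1 -> 0 <= K -> 0 < e ->
  exists N, forall n, (N <= n)%N -> c ^+ n * K <= e.
Proof.
move=> /andP[c0 c1] K0 e0; have K1 : 0 < K + 1 by rewrite ltr_wpDl.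
have : c ^+ n @[n --> \oo] --> (0 : R) by apply: cvg_expr; rewrite gtr0_norm.
move=> /cvgrPdist_le/(_ (e / (K + 1))); rewrite divr_gt0// => /(_ isT)[N _ cN].
exists N => n Nn; have cn0 : 0 <= c ^+ n by rewrite exprn_ge0// ltW.
have := cN n Nn; rewrite sub0r normrN ger0_norm// ler_pdivlMr//.
by apply: le_trans; rewrite ler_wpM2l// lerDl.
Qed.

Section RieffelDistance.
Variables (R : realType) (A : unitalCstarAlgType R) (Lip : set A) (L : A -> R).
Hypothesis hL : lipschitz_structure Lip L.

Lemma lip0 : L 0 = 0.
Proof. by rewrite -[0 in LHS](scale0r (0 : A)) (lipZ hL) ?Normc.normc0 ?mul0r//; exact: Lip0 hL. Qed.

Lemma le_rieffel_dist (mu nu : functional A) a : Lip a -> L a <= 1 ->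
  ((Normc.normc (mu a - nu a))%:E <= rieffel_dist Lip L mu nu)%E.
Proof. by move=> La L1; apply: ereal_sup_ubound; exists a. Qed.

Lemma rieffel_dist_ge0 (mu nu : functional A) : (0 <= rieffel_dist Lip L mu nu)%E.
Proof.
have := @le_rieffel_dist mu nu 0 (Lip0 hL); rewrite lip0 ler01 => /(_ isT).
by apply: le_trans; rewrite lee_fin; case: (_ - _) => ? ?; exact: sqrtr_ge0.
Qed.

End RieffelDistance.

Section AsymptoticallyScalar.
Variables (R : realType) (G : graph) (A : vertex G -> unitalCstarAlgType R).
Variables (Lip : forall v, set (A v)) (L : forall v, A v -> R).
Variable phi : forall e : edge G, A (src e) -> A (rng e).
Arguments phi : clear implicits.
Arguments Lip : clear implicits.
Arguments L : clear implicits.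
Hypothesis hMW : nc_mauldin_williams phi Lip L.

Let AA : cstarAlgType R := dsum (fun v => A v : cstarAlgType R).
Implicit Types (a b : AA) (e : edge G) (v : vertex G).

Let phi_hom := mw_hom hMW.
Let phi_unital := mw_unital hMW.

(** Removing the last letter replaces the states by their pullbacks, at the cost of one factor [c];
    hence the induction from the end of the word. At a vertex other than the range of the last edge
    both values are 0. *)
Lemma rieffel_word_le (c : R) : 0 < c ->
  (forall e (mu nu : functional (A (rng e))), states (A (rng e)) mu ->
     states (A (rng e)) nu ->
    (rieffel_dist (Lip (src e)) (L (src e)) (pullback phi mu) (pullback phi nu) <=
     c%:E * rieffel_dist (Lip (rng e)) (L (rng e)) mu nu)%E) ->
  forall w a, (forall u, Lip u (a u) /\ L u (a u) <= 1) ->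
  forall v (mu nu : functional (A v)), is_state mu -> is_state nu ->
  ((Normc.normc (mu (word_map phi w a v) - nu (word_map phi w a v)))%:E <=
   (c ^+ size w)%:E * rieffel_dist (Lip v) (L v) mu nu)%E.
Proof.
move=> c0 hc w a aL; elim/last_ind: w => [|w e IH] v mu nu mus nus.
  by rewrite mul1e /=; have [La L1] := aL v; exact: le_rieffel_dist.
rewrite word_map_rcons size_rcons; have [ev|ev] := eqVneq (rng e) v.
  case: v / ev mu nu mus nus => mu nu mus nus; rewrite /edge_map summand_same.
  have := IH _ (pullback phi mu) (pullback phi nu).
  move=> /(_ (pullback_state phi_hom phi_unital mus)).
  move=> /(_ (pullback_state phi_hom phi_unital nus)) /le_trans; apply.
  rewrite exprSr EFinM -muleA; apply: lee_pmul => //.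
  - by rewrite lee_fin exprn_ge0// ltW.
  - exact: rieffel_dist_ge0 (mw_lip hMW _) _ _.
  - exact: hc.
rewrite /edge_map summand_other// (state0 mus) (state0 nus) subrr Normc.normc0.
apply: mule_ge0; first by rewrite lee_fin exprn_ge0// ltW.
exact: rieffel_dist_ge0 (mw_lip hMW _) _ _.
Qed.

Lemma word_map_almost_scalar_Lip a (e : R) : (forall u, Lip u (a u)) -> 0 < e ->
  exists N, forall w, (N <= size w)%N ->
  exists k : vertex G -> R[i], nm (word_map phi w a - \sum_v k v *: summand1 A v) <= e.
Proof.
move=> aLip e0; have [c [c0 c1 hc]] := mw_contraction hMW.
have /choice[M HM] : forall v, exists M : R, forall mu nu : functional (A v),
    states (A v) mu -> states (A v) nu ->
    (rieffel_dist (Lip v) (L v) mu nu <= M%:E)%E.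
  by move=> v; exact: (rieffel_bounded (mw_lip hMW v)).
pose K := \sum_v `|M v|.
have MK v : M v <= K.
  by rewrite /K (bigD1 v)//= (le_trans (ler_norm _))// lerDl sumr_ge0.
have K0 : 0 <= K by rewrite sumr_ge0.
(* Dividing [a] by [t] makes all seminorms at most 1; the leading 1 keeps [t] positive. The 4 in the
   tolerance [e / t / 4] below is the constant of [nm_sub_scalar]. *)
pose t := 1 + \sum_v `|L v (a v)|.
have t0 : 0 < t by rewrite ltr_wpDr// sumr_ge0.
have tL v : L v (a v) <= t.
  rewrite /t (bigD1 v)//= (le_trans (ler_norm _))// addrCA lerDl.
  by rewrite addr_ge0// sumr_ge0.
pose b : AA := (t^-1)%:C *: a.
have bL v : Lip v (b v) /\ L v (b v) <= 1.
  split; first exact: LipZ (mw_lip hMW v) _ _ (aLip v).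
  rewrite [b v]/((t^-1)%:C *: (a v : A v)) (lipZ (mw_lip hMW v))//.
  have -> : Normc.normc (t^-1)%:C = t^-1.
    by rewrite /= expr0n addr0 sqrtr_sqr gtr0_norm// invr_gt0.
  by rewrite mulrC ler_pdivrMr// mul1r.
have d0 : 0 < e / t / 4 by rewrite !divr_gt0.
have [|N cN] := @exists_pow_le R c K _ _ K0 d0; first by rewrite c0 c1.
exists N => w Nw.
have /choice[k Hk] : forall v, exists k : R[i],
    nm (word_map phi w b v - k *: (cone : A v)) <= 4 * (e / t / 4).
  move=> v; have [nu nus] := exists_state (A v).
  apply: (nm_sub_scalar d0 nus) => mu mus; rewrite -lee_fin.
  apply: (le_trans (rieffel_word_le c0 hc w bL mus nus)).
  apply: (@le_trans _ _ ((c ^+ size w)%:E * K%:E)%E).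
    apply: lee_pmul => //; first by rewrite lee_fin exprn_ge0// ltW.
      exact: rieffel_dist_ge0 (mw_lip hMW _) _ _.
    by rewrite (le_trans (HM _ _ _ mus nus))// lee_fin.
  by rewrite -EFinM lee_fin cN.
exists (fun v => t%:C * k v).
apply: (@nm_dsum_le R _ A) => [|v]; first exact: ltW.
rewrite famDE famNE sum_scalars_summand.
have -> : word_map phi w a v = t%:C *: (word_map phi w b v : A v).
  rewrite /b (star_homZ (word_map_hom phi_hom w)) famZE scalerA -rmorphM.
  by rewrite mulfV ?gt_eqF// rmorph1 scale1r.
rewrite -scalerA -scalerBr nmZr gtr0_norm// mulrC -ler_pdivlMr//.
by rewrite (le_trans (Hk v))// mulrC divfK.
Qed.

(** Lipschitz elements are dense, and each [word_map phi w] is contractive, so a single Lipschitz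
    approximation of [a] serves for all words at once. *)
Lemma word_map_almost_scalar a (e : R) : 0 < e -> exists N, forall w, (N <= size w)%N ->
  exists k : vertex G -> R[i], nm (word_map phi w a - \sum_v k v *: summand1 A v) <= e.
Proof.
move=> e0; have e2 : 0 < e / 2 by rewrite divr_gt0.
have Hb v : exists x : A v, Lip v x /\ nm ((a v : A v) - x) <= e / 2.
  have := Lip_dense (mw_lip hMW v).
  move=> /(_ (ball (a v : A v) (e / 2)%:C)) [||x [xb xL]].
  - by exists (a v : A v); apply: ballxx; rewrite ltcR.
  - exact: ball_open.
  - by exists x; split=> //; move: xb; rewrite -ball_normE /= -nmE ltcR => /ltW.
pose a' : AA := fun v => sval (cid (Hb v)).
have [N HN] := @word_map_almost_scalar_Lip a' (e / 2) (fun u => (svalP (cid (Hb u))).1) e2.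
exists N => w /HN[k Hk]; exists k.
rewrite -(subrKA (word_map phi w a')) (le_trans (nmD _ _))// [leRHS]splitr lerD//.
apply: (le_trans (nm_star_homB (word_map_hom phi_hom w) a a')).
apply: (@nm_dsum_le R _ A) => [|v]; first exact: ltW.
exact: (svalP (cid (Hb v))).2.
Qed.

End AsymptoticallyScalar.

(** * Cuntz-Krieger families *)

Section Projections.
Variables (R : realType) (B : cstarAlgType R).
Implicit Types (p q x y : B) (s : R).

Lemma nm_proj_le1 p : star p = p -> p ** p = p -> nm p <= 1.
Proof.
move=> ps pp; have := nm_sa_sqr ps; rewrite pp => pE.
have [->|p0] := eqVneq (nm p) 0; first exact: ler01.
have p1 : nm p = 1 by apply: (mulfI p0); rewrite mulr1 -expr2.
by rewrite p1.
Qed.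

(* [y] and [- y] are both positive in the corner [p B p]. *)
Lemma corner_eq0 p y s : star p = p -> p ** p = p -> star y = y -> p ** y = y ->
  nm (p - y) <= 1 -> 0 < s -> nm (s%:C *: p + y) <= s -> y = 0.
Proof.
move=> ps pp ys py py1 s0 psy.
have yp : y ** p = y by rewrite -[in RHS]ys -{2}py starM ys ps.
(* The root [1 - c] needs a unit; inside the corner [p] takes its place and [p - p c] squares to
   [p - u]. *)
have corner_sqrt u : star u = u -> p ** u = u -> nm u <= 1 -> exists d,
    [/\ star d = d, p - u = d ** d & forall z, z ** p = p ** z ->
      z ** u = u ** z -> z ** d = d ** z].
  move=> us pu u1; have up : u ** p = u by rewrite -[in RHS]us -{2}pu starM us ps.
  have [c [cs _ ce cz]] := cstar_sqrt us u1.
  have pc : p ** c = c ** p by apply: cz; rewrite pu up.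
  exists (p - p ** c); split.
  - by rewrite starB starM ps cs pc.
  - have -> : (p - p ** c) ** (p - p ** c) = p - (p ** (c + c - c ** c)).
      have cpc : c ** (p ** c) = p ** (c ** c) by rewrite cmulA -pc -cmulA.
      rewrite cmulBl !cmulBr !cmulDr -[p ** c ** p]cmulA -pc !cmulA pp.
      rewrite -[p ** c ** p]cmulA -pc !cmulA pp.
      by linear_combination R[i].
    by rewrite ce addrK pu.
  - move=> z zp /cz zc.
    by rewrite cmulBl cmulBr zp cmulA zp -cmulA zc cmulA.
have [| |d [ds de dz]] := corner_sqrt (p - y) _ _ py1.
- by rewrite starB ps ys.
- by rewrite cmulBr pp py.
- have [| | |e [es ee ez]] := corner_sqrt (p + (s^-1)%:C *: y).
  + by rewrite starD starZr ps ys.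
  + by rewrite cmulDr cmulZr pp py.
  + have -> : p + (s^-1)%:C *: y = (s^-1)%:C *: (s%:C *: p + y).
      by rewrite scalerDr scalerA -rmorphM mulVf ?gt_eqF// rmorph1 scale1r.
    by rewrite nmZr normfV gtr0_norm// mulrC ler_pdivrMr// mul1r.
  have yd : y = d ** d by rewrite -de opprB addrC subrK.
  have ye : - y = s%:C *: (e ** e).
    rewrite -ee opprD addrA subrr add0r scalerN scalerA -rmorphM.
    by rewrite mulfV ?gt_eqF// rmorph1 scale1r.
  have pd : p ** d = d ** p by rewrite dz// cmulBr cmulBl py yp.
  have yyd : y ** d = d ** y by rewrite dz ?py ?yp// cmulBr cmulBl py yp.
  have ed : e ** d = d ** e.
    by apply/esym/ez => //; rewrite cmulDr cmulDl cmulZr cmulZl pd yyd.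
  (* Now [y = d^2] and [- y = e'^2] with [d], [e'] commuting, so [|d|^2 <= |d^2 + e'^2| = 0]. *)
  pose e' := (Num.sqrt s)%:C *: e.
  have := @nm_sqr_le_commuting R B d e' ds.
  rewrite starZr es => /(_ erefl); rewrite cmulZl cmulZr ed => /(_ erefl).
  rewrite cmulZl cmulZr scalerA -rmorphM -expr2 (sqr_sqrtr (ltW s0)) -yd -ye.
  rewrite subrr nm0 => d0; rewrite yd.
  suff -> : d = 0 by rewrite cmul0r.
  by apply/nm_eq0/eqP; rewrite -sqrf_eq0; apply/eqP/le_anti; rewrite d0 sqr_ge0.
Qed.

(** The map [x |-> x - 2 q x] is isometric, [1 - 2 q] being a symmetry, and [x - q x] is the mean of
    [x] and its image. *)
Lemma nm_sub_proj_le q x : star q = q -> q ** q = q -> nm (x - q ** x) <= nm x.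
Proof.
move=> qs qq.
have u : nm (x - (2%:R : R)%:C *: (q ** x)) = nm x.
  apply/eqP; rewrite -(@eqrXn2 _ 2)// ?nm_ge0// -!nm_star_mul; apply/eqP.
  congr nm; rewrite starB starZr starM qs cmulBl !cmulBr !cmulZl !cmulZr.
  rewrite -[star x ** q ** (q ** x)]cmulA [q ** (q ** x)]cmulA qq.
  by rewrite !cmulA rmorph_nat; linear_combination R[i].
have -> : x - q ** x = (2^-1)%:C *: (x + (x - (2%:R : R)%:C *: (q ** x))).
  by rewrite fmorphV !rmorph_nat; linear_combination R[i].
rewrite nmZr ger0_norm ?invr_ge0//.
by have := nmD x (x - (2%:R : R)%:C *: (q ** x)); rewrite u; lra.
Qed.

(* With [y_k = p_i p_k p_i], one has [0 <= y_k <= p_i] for all [k], while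
   [p_i + \sum_(k != i) y_k <= p_i]. *)
Lemma projections_sum_orthogonal (I : finType) (Q : pred I) (p : I -> B) :
  (forall i, Q i -> star (p i) = p i) -> (forall i, Q i -> p i ** p i = p i) ->
  (\sum_(i | Q i) p i) ** (\sum_(i | Q i) p i) = \sum_(i | Q i) p i ->
  forall i j, Q i -> Q j -> i != j -> p i ** p j = 0.
Proof.
move=> ps pp PP i j Qi Qj ij; set P := \sum_(i | Q i) p i in PP.
have Ps : star P = P by rewrite star_sum; apply: eq_bigr => k /ps.
pose y k := p i ** p k ** p i.
have ystar k : Q k -> star (y k) = y k.
  by move=> Qk; rewrite /y !starM !ps// cmulA.
have y1 k : Q k -> nm (p i - y k) <= 1.
  move=> Qk; pose z := p i - p k ** p i.
  have -> : p i - y k = star z ** z.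
    rewrite starB starM !ps// cmulBl !cmulBr pp//.
    rewrite -[p i ** p k ** (p k ** p i)]cmulA [p k ** (p k ** p i)]cmulA pp//.
    by rewrite cmulA subrr subr0.
  rewrite nm_star_mul expr_le1// ?nm_ge0//.
  by rewrite (le_trans (nm_sub_proj_le _ (ps _ Qk) (pp _ Qk)))// nm_proj_le1 ?ps ?pp.
have pPp : p i ** P ** p i = p i + (y j + \sum_(k | Q k && (k != i) && (k != j)) y k).
  rewrite /P cmul_sumr cmul_suml (bigD1 i)//= !pp//; congr (_ + _).
  by rewrite (bigD1 j)//= Qj eq_sym.
have pPp1 : nm (p i ** P ** p i) <= 1.
  have p1 := nm_proj_le1 (ps _ Qi) (pp _ Qi); have P1 := nm_proj_le1 Ps PP.
  rewrite (le_trans (nmM _ _))// mulr_ile1 ?nm_ge0//.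
  by rewrite (le_trans (nmM _ _))// mulr_ile1 ?nm_ge0.
suff yj0 : y j = 0.
  apply: (can_inj (@starK _ B)); rewrite star0 starM !ps//.
  apply: star_mul_eq0; rewrite starM !ps// cmulA -[p i ** p j ** p j]cmulA pp//.
(* [m] counts the indices other than [i] and [j]. As [p_i P p_i = p_i + y_j + T], one has [(m + 1)
   p_i + y_j = p_i P p_i + (m p_i - T)], of norm at most [1 + m]: the hypothesis of [corner_eq0] for
   [s = m + 1]. *)
pose m : R := #|[pred k | Q k && (k != i) && (k != j)]|%:R.
have m0 : 0 <= m by rewrite ler0n.
apply: (@corner_eq0 (p i) _ (m + 1)); rewrite ?ps ?pp ?ystar ?y1//.
- by rewrite /y !cmulA pp.
- by rewrite ltr_wpDl.
set T := \sum_(k | _) y k in pPp.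
have nT : nm (m%:C *: p i - T) <= m.
  have -> : m%:C *: p i - T = \sum_(k | Q k && (k != i) && (k != j)) (p i - y k).
    rewrite sumrB sumr_const /m rmorph_nat scaler_nat; congr (_ *+ _ - _).
  rewrite (le_trans (nm_sum _ _ _))// /m -sum1_card natr_sum.
  by apply: ler_sum => k /andP[/andP[Qk _] _]; exact: y1.
have -> : (m + 1)%:C *: p i + y j = p i ** P ** p i + (m%:C *: p i - T).
  by rewrite pPp rmorphD rmorph1; linear_combination R[i].
by rewrite (le_trans (nmD _ _))// addrC lerD.
Qed.

End Projections.

(** By Bernoulli's inequality the powers of [x > 1] are unbounded. The exponents [2 ^ n] are those
    that arise from repeated squaring by the C*-identity. *)
Lemma le1_of_pow_bounded (R : realType) (x K : R) :
  (forall n, x ^+ (2 ^ n) <= K) -> x <= 1.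
Proof.
move=> xK; rewrite leNgt; apply/negP => x1.
have bernoulli n : 1 + n%:R * (x - 1) <= x ^+ n.
  elim: n => [|n IH]; first by rewrite mul0r addr0 expr0.
  rewrite exprS (@le_trans _ _ (x * (1 + n%:R * (x - 1))))//; last first.
    by rewrite ler_wpM2l// (le_trans _ (ltW x1)).
  have n0 : (0 : R) <= n%:R by [].
  have := mulr_ge0 n0 (sqr_ge0 (x - 1)).
  by rewrite -natr1; move: (n%:R : R) => m; lra.
pose n := (Num.truncn (K / (x - 1))).+1.
have d0 : 0 < x - 1 by rewrite subr_gt0.
have nK : K < n%:R * (x - 1).
  by rewrite -ltr_pdivrMr// /n truncnS_gt.
have := le_trans (bernoulli (2 ^ n)%N) (xK n).
have : n%:R * (x - 1) <= (2 ^ n)%:R * (x - 1).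
  by rewrite (ler_wpM2r (ltW d0))// ler_nat ltnW// ltn_expl.
by move: nK; lra.
Qed.

(** * Orthogonality of edge ranges and the norm of compressions *)

Section CKFamily.
Variables (R : realType) (G : graph) (B : cstarAlgType R).
Variables (P : vertex G -> B) (S : edge G -> B).
Hypothesis ck : ck_family P S.
Implicit Types (e f : edge G) (v w : vertex G) (b : edge G -> B).

Lemma ck_star_proj v : star (P v) = P v. Proof. by case: (ck_proj ck v). Qed.
Lemma ck_projK v : P v ** P v = P v. Proof. by case: (ck_proj ck v). Qed.

Lemma ck_projE v w : P v ** P w = if v == w then P v else 0.
Proof. by have [<-|/(ck_orthogonal ck)//] := eqVneq v w; exact: ck_projK. Qed.

Lemma nm_ck_proj v : nm (P v) <= 1.
Proof. by apply: nm_proj_le1; rewrite ?ck_star_proj ?ck_projK. Qed.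

Lemma nm_ck_edge e : nm (S e) <= 1.
Proof.
rewrite -(@expr_le1 _ 2)// ?nm_ge0// -nm_star_mul (ck_source_proj ck).
exact: nm_ck_proj.
Qed.

Lemma ck_edge_rng e : S e ** P (rng e) = S e.
Proof. by rewrite -(ck_source_proj ck) cmulA (ck_partial_isometry ck). Qed.

Let p e := S e ** star (S e).

Let ps e : star (p e) = p e. Proof. by rewrite starM starK. Qed.
Let pp e : p e ** p e = p e.
Proof. by rewrite /p cmulA (ck_partial_isometry ck). Qed.

Let sumP v e : src e = v -> P v = \sum_(f : edge G | src f == v) p f.
Proof. by move=> ev; rewrite (ck_sum ck)//; exists e. Qed.

(** The range projections at the common source sum to the projection [P (src f)], so
    [projections_sum_orthogonal] applies. *)
Let p_orth e f : e != f -> src e = src f -> p e ** p f = 0.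
Proof.
move=> ef sef.
apply: (@projections_sum_orthogonal R B (edge G) (fun g => src g == src f) p) => //.
- by rewrite -!(sumP (erefl (src f))) ck_projK.
- by rewrite sef.
Qed.

Let Pp e : P (src e) ** p e = p e.
Proof.
rewrite (sumP (erefl (src e))) cmul_suml (bigD1 e)//= pp big1 ?addr0//.
by move=> f /andP[/eqP fe ef]; exact: p_orth.
Qed.

Lemma ck_src_edge v e : P v ** S e = if v == src e then S e else 0.
Proof.
have SeE : S e = P (src e) ** S e.
  by rewrite -[in LHS](ck_partial_isometry ck) -/(p e) -Pp -cmulA
    [p e ** _](ck_partial_isometry ck).
by rewrite SeE cmulA ck_projE; case: eqVneq => [->|_]; rewrite ?cmul0r.
Qed.

Lemma ck_edge_orthogonal e f : star (S e) ** S f = if e == f then P (rng e) else 0.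
Proof.
have [<-|ef] := eqVneq e f; first exact: (ck_source_proj ck).
have pS g : p g ** S g = S g by exact: (ck_partial_isometry ck).
rewrite -(pS e) -(pS f) starM ps -cmulA [p e ** (p f ** _)]cmulA.
suff -> : p e ** p f = 0 by rewrite cmul0r cmulr0.
have [sef|sef] := eqVneq (src e) (src f); first exact: p_orth.
rewrite -(ps e) -Pp -(Pp f) starM ps ck_star_proj -cmulA [P _ ** (P _ ** _)]cmulA.
by rewrite ck_projE (negPf sef) cmul0r cmulr0.
Qed.

Definition compress b : B := \sum_e S e ** b e ** star (S e).

Lemma compress_star b : star (compress b) = compress (fun e => star (b e)).
Proof.
rewrite star_sum; apply: eq_bigr => e _.
by rewrite !starM starK cmulA.
Qed.

Lemma compressM b b' :
  compress b ** compress b' = compress (fun e => b e ** P (rng e) ** b' e).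
Proof.
rewrite cmul_suml; apply: eq_bigr => e _; rewrite cmul_sumr (bigD1 e)//= big1.
  rewrite addr0 !cmulA -[_ ** star (S e) ** S e]cmulA ck_edge_orthogonal eqxx.
  by rewrite ?cmulA.
move=> f fe; rewrite !cmulA -[_ ** star (S e) ** S f]cmulA ck_edge_orthogonal.
by rewrite eq_sym (negPf fe) cmulr0 !cmul0r.
Qed.

Lemma compressD b b' : compress b + compress b' = compress (fun e => b e + b' e).
Proof.
by rewrite -big_split; apply: eq_bigr => e _ /=; rewrite cmulDr cmulDl.
Qed.

Lemma compressZ (k : R[i]) b : k *: compress b = compress (fun e => k *: b e).
Proof.
by rewrite scaler_sumr; apply: eq_bigr => e _; rewrite cmulZr cmulZl.
Qed.

Lemma compressB b b' : compress b - compress b' = compress (fun e => b e - b' e).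
Proof.
rewrite -scaleN1r compressZ compressD; apply: eq_bigr => e _.
by rewrite scaleN1r.
Qed.

(* Iterating the C*-identity turns the trivial bound [#|edge G|] into its
   [2 ^ n]-th root. *)
Let nm_compress_pow n b : (forall e, nm (b e) <= 1) ->
  nm (compress b) ^+ (2 ^ n) <= #|edge G|%:R.
Proof.
elim: n b => [|n IH] b b1.
  rewrite expn0 expr1 (le_trans (nm_sum _ _ _))// -sum1_card natr_sum.
  apply: ler_sum => e _; have S1 := nm_ck_edge e.
  rewrite (le_trans (nmM _ _))// nm_star mulr_ile1 ?nm_ge0//.
  by rewrite (le_trans (nmM _ _))// mulr_ile1 ?nm_ge0.
rewrite expnS exprM -nm_star_mul compress_star compressM; apply: IH => e.
have P1 := nm_ck_proj (rng e).
rewrite (le_trans (nmM _ _))// mulr_ile1 ?nm_ge0//.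
by rewrite (le_trans (nmM _ _))// mulr_ile1 ?nm_ge0// nm_star.
Qed.

(** With no factor counting edges, errors do not grow when compressions are nested along words.
    Rescaling by [M] reduces the bound to [nm_compress_pow]; [M = 0] is treated apart. *)
Lemma nm_compress_le b (M : R) : 0 <= M -> (forall e, nm (b e) <= M) ->
  nm (compress b) <= M.
Proof.
rewrite le_eqVlt => /predU1P[<- b0|M0 bM].
  rewrite /compress big1 ?nm0// => e _.
  have -> : b e = 0 by apply/nm_eq0/le_anti; rewrite b0 nm_ge0.
  by rewrite cmulr0 cmul0r.
have -> : compress b = M%:C *: compress (fun e => (M^-1)%:C *: b e).
  by rewrite -compressZ scalerA -rmorphM mulfV ?gt_eqF// rmorph1 scale1r.
rewrite nmZr gtr0_norm// (ler_piMr (ltW M0))//; apply: le1_of_pow_bounded => n.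
apply: nm_compress_pow => e.
by rewrite nmZr normfV gtr0_norm// mulrC ler_pdivrMr// mul1r.
Qed.

End CKFamily.

(** * Limits and state bounds *)

Section Limits.
Variables (R : realType) (A B : cstarAlgType R).

Definition lim_to (T : cstarAlgType R) (u : nat -> T) (l : T) : Prop :=
  forall e, 0 < e -> exists N, forall n, (N <= n)%N -> nm (l - u n) <= e.

Lemma lim_to_unique (u : nat -> A) x y : lim_to u x -> lim_to u y -> x = y.
Proof.
move=> ux uy; apply/subr0_eq/nm_small_eq0 => e e0.
have e2 : 0 < e / 2 by rewrite divr_gt0.
have [[N xN] [N' yN]] := (ux _ e2, uy _ e2).
rewrite -(subrKA (u (maxn N N'))) (le_trans (nmD _ _))// [leRHS]splitr lerD//.
  by rewrite xN ?leq_maxl.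
by rewrite nm_distC yN ?leq_maxr.
Qed.

Lemma lim_to_cst (x : A) : lim_to (fun=> x) x.
Proof. by move=> e e0; exists 0%N => n _; rewrite subrr nm0 ltW. Qed.

Lemma lim_toS (u : nat -> A) x : lim_to u x -> lim_to (fun n => u n.+1) x.
Proof. by move=> ux e /ux[N xN]; exists N => n Nn; rewrite xN// leqW. Qed.

Lemma lim_toD (u v : nat -> A) x y : lim_to u x -> lim_to v y ->
  lim_to (fun n => u n + v n) (x + y).
Proof.
move=> ux vy e e0; have e2 : 0 < e / 2 by rewrite divr_gt0.
have [[N xN] [N' yN]] := (ux _ e2, vy _ e2).
exists (maxn N N') => n; rewrite geq_max => /andP[Nn N'n].
by rewrite opprD addrACA (le_trans (nmD _ _))// [leRHS]splitr lerD ?xN ?yN.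
Qed.

Lemma lim_to_map (f : A -> B) (K : R) (u : nat -> A) x : 0 <= K ->
  (forall y z, nm (f y - f z) <= K * nm (y - z)) -> lim_to u x ->
  lim_to (f \o u) (f x).
Proof.
move=> K0 fK ux e e0; have K1 : 0 < K + 1 by rewrite ltr_wpDl.
have [|N xN] := ux (e / (K + 1)); first exact: divr_gt0.
exists N => n /xN; rewrite ler_pdivlMr// => h.
rewrite (le_trans (fK _ _))// (le_trans _ h)// mulrC ler_wpM2l ?nm_ge0//.
by rewrite lerDl.
Qed.

Lemma lim_to_sum (I : Type) (r : seq I) (u : I -> nat -> A) (x : I -> A) :
  (forall i, lim_to (u i) (x i)) ->
  lim_to (fun n => \sum_(i <- r) u i n) (\sum_(i <- r) x i).
Proof.
move=> ux; elim: r => [|i r IH].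
  by rewrite big_nil; under eq_fun do rewrite big_nil; exact: lim_to_cst.
by rewrite big_cons; under eq_fun do rewrite big_cons; exact: lim_toD.
Qed.

Lemma nm_lim_le (u : nat -> A) x (M : R) : lim_to u x ->
  (forall n, nm (u n) <= M) -> nm x <= M.
Proof.
move=> ux uM; apply/ler_addgt0Pl => e /ux[N /(_ N (leqnn N)) xN].
by rewrite -(subrK (u N) x) (le_trans (nmD _ _))// lerD.
Qed.

End Limits.

Section Operations.
Variables (R : realType) (A : cstarAlgType R).
Implicit Types (u : nat -> A) (x y : A).

Lemma lim_toZ (k : R[i]) u x : lim_to u x -> lim_to (fun n => k *: u n) (k *: x).
Proof.
apply: (@lim_to_map R A A ( *:%R k) (Normc.normc k)).
  by case: k => a b; exact: sqrtr_ge0.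
by move=> y z; rewrite -scalerBr nmZ.
Qed.

Lemma lim_to_cmull y u x : lim_to u x -> lim_to (fun n => y ** u n) (y ** x).
Proof.
apply: (@lim_to_map R A A (cmul y) (nm y)); first exact: nm_ge0.
by move=> z t; rewrite -cmulBr nmM.
Qed.

Lemma lim_to_cmulr y u x : lim_to u x -> lim_to (fun n => u n ** y) (x ** y).
Proof.
apply: (@lim_to_map R A A (cmul^~ y) (nm y)); first exact: nm_ge0.
by move=> z t; rewrite -cmulBl mulrC nmM.
Qed.

Lemma lim_to_star u x : lim_to u x -> lim_to (fun n => star (u n)) (star x).
Proof.
apply: (@lim_to_map R A A (@star _ A) 1); first exact: ler01.
by move=> z t; rewrite -starB nm_star mul1r.
Qed.

End Operations.

Section StateBounds.
Variables (R : realType) (A : unitalCstarAlgType R) (mu : functional A).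
Hypothesis mus : is_state mu.
Implicit Types (a b c : A).

Lemma state_sa_le b : star b = b -> Normc.normc (mu b) <= nm b.
Proof.
move=> bs; rewrite (state_sa_real mus bs) /= expr0n addr0 sqrtr_sqr.
have le (x : A) : star x = x -> complex.Re (mu x) <= nm x.
  move=> xs; have [d [ds de _ _]] := scalar_sub_sqrt xs (lexx _).
  have [_ mupos mu1] := mus; have := mupos d; rewrite ds -de.
  by rewrite (stateP mus) (stateN mus) mu1 mulr1 subr_ge0 lecE /= => /andP[].
rewrite ler_norml lerNl le// andbT.
have := le (- b); rewrite starN bs (stateN mus) nmN => /(_ erefl).
by rewrite raddfN.
Qed.

Lemma normc_state_le a : Normc.normc (mu a) <= 2 * nm a.
Proof.
have [b [c [bs cs ae ba ca]]] := sa_decomposition a.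
rewrite {1}ae (stateP mus) (le_trans (le_normcD _ _))//.
rewrite Normc.normcM; have -> : Normc.normc ('i : R[i]) = 1.
  by rewrite /= expr0n add0r expr1n sqrtr1.
rewrite mul1r mulr2n mulrDl mul1r lerD//.
  exact: le_trans (state_sa_le cs) ca.
exact: le_trans (state_sa_le bs) ba.
Qed.

Lemma state_star a : mu (star a) = (mu a)^*.
Proof.
have [b [c [bs cs ae _ _]]] := sa_decomposition a.
have -> : star a = (- 'i) *: c + b by rewrite ae starD starZ bs cs conjCi.
rewrite ae !(stateP mus) (state_sa_real mus bs) (state_sa_real mus cs).
by rewrite rmorphD rmorphM /= conjCi !conj_Creal ?complex_real.
Qed.

End StateBounds.

(** * Fixed points of the transfer operation *)

Section CompressIteration.
Variables (R : realType) (G : graph) (B : cstarAlgType R).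
Variables (P : vertex G -> B) (S : edge G -> B).
Hypothesis ck : ck_family P S.
Variables (X : Type) (act : edge G -> X -> X).

Fixpoint act_word (w : seq (edge G)) (x : X) : X :=
  if w is e :: w' then act_word w' (act e x) else x.

(** [X] is abstract because the estimate serves for single elements and, in the proof of
    multiplicativity, for pairs. By [nm_compress_le] no constant is lost at any level. *)
Lemma nm_compress_iter (d : nat -> X -> B) (M : R) : 0 <= M ->
  (forall n x, d n.+1 x = compress S (fun e => d n (act e x))) ->
  forall n x, (forall w, size w = n -> nm (d 0 (act_word w x)) <= M) ->
  nm (d n x) <= M.
Proof.
move=> M0 dS; elim=> [|n IH] x dM; first exact: (dM [::]).
rewrite dS; apply: (nm_compress_le ck) => // e; apply: IH => w wn.
by apply: (dM (e :: w)); rewrite /= wn.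
Qed.

End CompressIteration.

Section Transfer.
Variables (R : realType) (G : graph) (A : vertex G -> unitalCstarAlgType R).
Variable phi : forall e : edge G, A (src e) -> A (rng e).
Arguments phi : clear implicits.
Hypotheses (phi_hom : forall e, star_hom (phi e))
  (phi_unital : forall e, phi e cone = cone).

Let AA : cstarAlgType R := dsum (fun v => A v : cstarAlgType R).
Implicit Types (a b : AA) (v : vertex G).

Hypothesis almost_scalar : forall a (e : R), 0 < e -> exists N, forall w,
  (N <= size w)%N ->
  exists k : vertex G -> R[i], nm (word_map phi w a - \sum_v k v *: summand1 A v) <= e.

Variables (B : cstarAlgType R) (P : vertex G -> B) (S : edge G -> B).
Hypotheses (ck : ck_family P S).

(** Covariant representations have [pi] as a fixed point ([pi_transfer]), and fixed homomorphisms
    with the right vertex values give covariant representations ([ck_covariant]). *)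
Definition transfer (theta : AA -> B) : AA -> B :=
  fun a => compress S (fun e => theta (edge_map phi e a)).

Lemma act_word_map w a : act_word (edge_map phi) w a = word_map phi w a.
Proof. by elim: w a => /=. Qed.

Lemma nm_iter_transferB (theta eta : AA -> B) (M : R) n a : 0 <= M ->
  (forall w, size w = n -> nm (theta (word_map phi w a) - eta (word_map phi w a)) <= M) ->
  nm (iter n transfer theta a - iter n transfer eta a) <= M.
Proof.
move=> M0 wM; pose d m x := iter m transfer theta x - iter m transfer eta x.
apply: (nm_compress_iter (act := edge_map phi) (d := d) ck M0).
  by move=> m x; rewrite /d /= compressB.
by move=> w wn; rewrite act_word_map; exact: wM.
Qed.

(** Both maps equal their own [N]-th transfers, so their distance at [a] is at most their distance
    at the almost scalar [word_map phi w a]; they agree on the scalar parts and are contractive on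
    the remainders. *)
Lemma transfer_fixed_unique (theta eta : AA -> B) :
  transfer theta = theta -> transfer eta = eta ->
  star_hom theta -> star_hom eta ->
  (forall v, theta (summand1 A v) = eta (summand1 A v)) -> theta = eta.
Proof.
move=> tf ef th eh te; apply/funext => a; apply/subr0_eq/nm_small_eq0 => e e0.
have e2 : 0 < e / 2 by rewrite divr_gt0.
have [N HN] := almost_scalar a e2.
have fixedE (f : AA -> B) : transfer f = f -> f = iter N transfer f.
  by move=> ff; elim: N {HN} => //= n <-.
rewrite (fixedE _ tf) (fixedE _ ef); apply: nm_iter_transferB; first exact: ltW.
move=> w wN; have [|k Hk] := HN w; first by rewrite wN.
set z := \sum_v _ in Hk; set b := word_map phi w a in Hk *.
have tez : theta z = eta z.
  rewrite /z (star_hom_sum th) (star_hom_sum eh); apply: eq_bigr => v _.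
  by rewrite (star_homZ th) (star_homZ eh) te.
have -> : theta b - eta b = (theta b - theta z) - (eta b - eta z).
  by rewrite tez; linear_combination R[i].
rewrite (le_trans (nmB _ _))// [leRHS]splitr lerD//.
  exact: le_trans (nm_star_homB th _ _) Hk.
exact: le_trans (nm_star_homB eh _ _) Hk.
Qed.

Variable nu : forall v, functional (A v).
Arguments nu : clear implicits.
Hypothesis nus : forall v, is_state (nu v).
Hypothesis no_sinks_G : no_sinks G.

Definition initial_map a : B := \sum_v nu v (a v) *: P v.

(** The 2 is that of [normc_state_le], the count that of the terms of [initial_map]; the resulting
    bound holds at every stage, uniformly in [n]. *)
Let K : R := 2 * #|vertex G|%:R.
Let K0 : 0 <= K. Proof. by rewrite mulr_ge0. Qed.

Definition approx_map n : AA -> B := iter n transfer initial_map.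

Lemma approx_map_linear n (k : R[i]) a b :
  approx_map n (k *: a + b) = k *: approx_map n a + approx_map n b.
Proof.
elim: n a b => [|n IH] a b /=.
  rewrite /initial_map scaler_sumr -big_split; apply: eq_bigr => v _ /=.
  by rewrite scalerA -scalerDl -(stateP (nus v)).
rewrite /transfer compressZ compressD; apply: eq_bigr => e _.
by rewrite (star_hom_linear (edge_map_hom phi_hom e)) IH.
Qed.

Lemma approx_mapB n a b : approx_map n (a - b) = approx_map n a - approx_map n b.
Proof. by rewrite -scaleN1r addrC approx_map_linear scaleN1r addrC. Qed.

Lemma nm_approx_map n a : nm (approx_map n a) <= K * nm a.
Proof.
have i0 b : nm (initial_map b) <= K * nm b.
  rewrite (le_trans (nm_sum _ _ _))// /K mulrAC -sum1_card natr_sum mulr_sumr.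
  apply: ler_sum => v _; rewrite nmZ mulr1 (@le_trans _ _ (Normc.normc (nu v (b v))))//.
    rewrite ler_piMr ?(nm_ck_proj ck)//; case: (nu v (b v)) => *; exact: sqrtr_ge0.
  rewrite (le_trans (normc_state_le (nus v) _))// ler_wpM2l//.
  exact: (@nm_summand_le R _ A).
apply: (nm_compress_iter (act := edge_map phi) (d := approx_map) ck).
- by rewrite mulr_ge0 ?nm_ge0.
- by [].
- move=> w _; rewrite act_word_map (le_trans (i0 _))// ler_wpM2l//.
  exact: nm_star_hom (word_map_hom phi_hom w) a.
Qed.

Lemma approx_map_star n a : approx_map n (star a) = star (approx_map n a).
Proof.
elim: n a => [|n IH] a /=.
  rewrite /initial_map star_sum; apply: eq_bigr => v _.
  by rewrite starZ (ck_star_proj ck) -(state_star (nus v)).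
rewrite /transfer compress_star; apply: eq_bigr => e _.
by rewrite (star_hom_star (edge_map_hom phi_hom e)) IH.
Qed.

(** The absence of sinks enters here: the transferred value is the sum of [S_e P_(rng e) S_e^*] over
    the edges with source [v], and [ck_sum] identifies it with [P v] when such an edge exists. *)
Lemma approx_map_summand1 n v : approx_map n (summand1 A v) = P v.
Proof.
elim: n v => [|n IH] v /=.
  rewrite /initial_map (bigD1 v)//= /summand1 summand_same.
  have [_ _ ->] := nus v; rewrite scale1r big1 ?addr0// => w wv.
  by rewrite summand_other 1?eq_sym// (state0 (nus w)) scale0r.
have an0 : approx_map n 0 = 0.
  by apply: (addrI (1 *: approx_map n 0)); rewrite -approx_map_linear scaler0 !addr0 scale1r.
rewrite (ck_sum ck (no_sinks_G v)) [RHS]big_mkcond; apply: eq_bigr => e _.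
rewrite edge_map1//; case: eqVneq => _; last by rewrite an0 cmulr0 cmul0r.
by rewrite IH (ck_edge_rng ck).
Qed.

(** The approximations need not be multiplicative, but multiplication by vertex units survives at
    every stage. In the limit this absorbs the projections [P (rng e)] produced by [compressM]. *)
Lemma approx_map_cmul n v a : approx_map n (summand1 A v ** a) = P v ** approx_map n a.
Proof.
elim: n v a => [|n IH] v a /=.
  rewrite summand1_cmul /initial_map cmul_sumr; apply: eq_bigr => w _.
  rewrite cmulZr (ck_projE ck); have [<-|vw] := eqVneq v w.
    by rewrite summand_same.
  by rewrite summand_other// (state0 (nus w)) scale0r scaler0.
have an0 : approx_map n 0 = 0.
  by apply: (addrI (1 *: approx_map n 0)); rewrite -approx_map_linear scaler0 !addr0 scale1r.
rewrite /transfer /compress cmul_sumr; apply: eq_bigr => e _.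
rewrite (star_hom_cmul (edge_map_hom phi_hom e)) edge_map1//.
rewrite [P v ** _]cmulA [P v ** _]cmulA (ck_src_edge ck) [v == _]eq_sym.
have [_|_] := eqVneq (src e) v; last by rewrite !cmul0r an0 cmulr0 cmul0r.
by rewrite IH cmulA (ck_edge_rng ck).
Qed.

(** Two late approximations are [N]-fold transfers of earlier ones, so only their difference at
    almost scalar elements counts. Scalar parts have the same value at every stage, and the
    remainders cost [K] twice, whence the tolerance [e / (2 * K + 1)]. *)
Lemma approx_map_cauchy a : exists l, lim_to (approx_map^~ a) l.
Proof.
apply: nm_cauchy_lim => e e0; have d0 : 0 < e / (2 * K + 1).
  by rewrite divr_gt0// ltr_wpDl// mulr_ge0.
have [N HN] := almost_scalar a d0; exists N => m n Nm Nn.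
have iterE j : (N <= j)%N -> approx_map j = iter N transfer (approx_map (j - N)).
  by move=> Nj; rewrite /approx_map -iterD subnKC.
rewrite (iterE m)// (iterE n)//; apply: nm_iter_transferB; first exact: ltW.
move=> w wN; have [|k Hk] := HN w; first by rewrite wN.
set z := \sum_v _ in Hk; set b := word_map phi w a in Hk *.
have scalar_fixed j : approx_map j z = approx_map 0 z.
  rewrite /z; elim/big_ind: _ => [|x y hx hy|v _].
  - by rewrite -(subrr 0) !approx_mapB !subrr.
  - by rewrite -[x]scale1r !approx_map_linear hx hy.
  - by rewrite -[_ *: _]addr0 -(subrr 0) !approx_map_linear !approx_mapB
      !approx_map_summand1 !subrr.
have -> : approx_map (m - N) b - approx_map (n - N) b =
    approx_map (m - N) (b - z) - approx_map (n - N) (b - z).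
  rewrite !approx_mapB (scalar_fixed (m - N)%N) (scalar_fixed (n - N)%N).
  by linear_combination R[i].
rewrite (le_trans (nmB _ _))// (@le_trans _ _ (K * nm (b - z) + K * nm (b - z)))//.
  by rewrite lerD// nm_approx_map.
rewrite -mulr2n -mulr_natl mulrA; move: Hk; rewrite ler_pdivlMr; last first.
  by rewrite ltr_wpDl// mulr_ge0.
by have := nm_ge0 (b - z); nra.
Qed.

(* Multiplicativity: the defect [delta (a, b)] is a fixed point of a two-variable
   transfer operation and vanishes when [a] is scalar. *)
Lemma exists_transfer_fixed : exists theta : AA -> B,
  [/\ star_hom theta, transfer theta = theta & forall v, theta (summand1 A v) = P v].
Proof.
have /choice[theta Ht] := approx_map_cauchy; exists theta.
have theta_lin (k : R[i]) a b : theta (k *: a + b) = k *: theta a + theta b.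
  apply: (lim_to_unique (Ht _)).
  under eq_fun do rewrite approx_map_linear.
  by apply: lim_toD => //; exact: lim_toZ.
have theta_star a : theta (star a) = star (theta a).
  apply: (lim_to_unique (Ht _)).
  under eq_fun do rewrite approx_map_star.
  exact: lim_to_star.
have theta_fixed : transfer theta = theta.
  apply/funext => a; apply: lim_to_unique (lim_toS (Ht a)).
  apply: lim_to_sum => e; apply: lim_to_cmulr; apply: lim_to_cmull; exact: Ht.
have theta1 v : theta (summand1 A v) = P v.
  apply: (lim_to_unique (Ht _)).
  under eq_fun do rewrite approx_map_summand1.
  exact: lim_to_cst.
have theta_cmul v a : theta (summand1 A v ** a) = P v ** theta a.
  apply: (lim_to_unique (Ht _)).
  under eq_fun do rewrite approx_map_cmul.
  exact: lim_to_cmull.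
have nm_theta a : nm (theta a) <= K * nm a.
  by apply: (nm_lim_le (Ht a)) => n; exact: nm_approx_map.
split=> //; split=> // a b; apply/subr0_eq.
pose delta (x : AA * AA) := theta (x.1 ** x.2) - theta x.1 ** theta x.2.
rewrite -[LHS]/(delta (a, b)); apply: nm_small_eq0 => e e0.
pose act g (x : AA * AA) := (edge_map phi g x.1, edge_map phi g x.2).
(* [compressM] puts [P (rng g)] between the factors; [theta_cmul] absorbs it, since [edge_map phi g]
   lands in the summand at [rng g]. *)
have deltaS x : delta x = compress S (fun g => delta (act g x)).
  rewrite /delta -{1 2 3}theta_fixed /transfer (compressM ck) compressB.
  apply: eq_bigr => g _; congr (_ ** _ ** _); rewrite /act /=.
  rewrite (star_hom_cmul (edge_map_hom phi_hom g)).
  rewrite -cmulA -theta_cmul; congr (_ - _ ** theta _).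
  by rewrite summand1_cmul /edge_map summand_same.
have thetaB x y : theta (x - y) = theta x - theta y.
  by rewrite -scaleN1r addrC theta_lin scaleN1r addrC.
have delta_z (k : vertex G -> R[i]) y : delta (\sum_v k v *: summand1 A v, y) = 0.
  have theta0 : theta 0 = 0 by rewrite -(subrr 0) thetaB subrr.
  rewrite /delta /= cmul_suml; elim/big_rec2: _.
    by rewrite theta0 cmul0r subrr.
  move=> v x z _ h; rewrite cmulZl !theta_lin theta_cmul theta1 cmulDl cmulZl.
  by rewrite opprD addrACA subrr add0r.
(* The two terms bound [theta (x ** b')] and [theta x ** theta b'], up to the factor [nm x]. *)
pose M := K * nm b + K * K * nm b.
have M0 : 0 <= M by rewrite addr_ge0 ?mulr_ge0 ?nm_ge0.
have d0 : 0 < e / (M + 1) by rewrite divr_gt0// ltr_wpDl.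
have [N HN] := almost_scalar a d0.
apply: (nm_compress_iter (act := act) (d := fun=> delta) ck (ltW e0) _ (n := N)).
  by move=> _ x; exact: deltaS.
move=> w wN; have -> : act_word act w (a, b) = (word_map phi w a, word_map phi w b).
  by elim: w a b {wN deltaS HN M M0 d0} => //= g w IH a b; rewrite IH.
have [|k Hk] := HN w; first by rewrite wN.
set z := \sum_v _ in Hk; set a' := word_map phi w a in Hk *.
have nb : nm (word_map phi w b) <= nm b := nm_star_hom (word_map_hom phi_hom w) b.
set b' := word_map phi w b in nb *.
have -> : delta (a', b') = delta (a' - z, b').
  have /subr0_eq dz := delta_z k b'; rewrite -/z /= in dz.
  by rewrite /delta /= cmulBl !thetaB cmulBl dz; linear_combination R[i].
rewrite /delta /= (le_trans (nmB _ _))//.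
have Hk' : nm (a' - z) * M <= e.
  move: Hk; rewrite ler_pdivlMr ?ltr_wpDl//; apply: le_trans.
  by rewrite ler_wpM2l ?nm_ge0// lerDl.
apply: (le_trans _ Hk').
have n1 : nm (theta ((a' - z) ** b')) <= K * (nm (a' - z) * nm b).
  rewrite (le_trans (nm_theta _))// ler_wpM2l// (le_trans (nmM _ _))//.
  by rewrite ler_wpM2l ?nm_ge0.
have n2 : nm (theta (a' - z) ** theta b') <= K * nm (a' - z) * (K * nm b).
  rewrite (le_trans (nmM _ _))// ler_pM ?nm_ge0// (le_trans (nm_theta _))//.
  by rewrite ler_wpM2l.
have -> : nm (a' - z) * M =
    K * (nm (a' - z) * nm b) + K * nm (a' - z) * (K * nm b) by rewrite /M; ring.
exact: lerD.
Qed.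

End Transfer.

(** * The correspondence *)

Lemma linear_sum (R : realType) (V W : lmodType R[i]) (T : V -> W) (I : Type) (r : seq I) (F : I -> V) :
  (forall (k : R[i]) x y, T (k *: x + y) = k *: T x + T y) ->
  T (\sum_(i <- r) F i) = \sum_(i <- r) T (F i).
Proof.
move=> Tl; have T0 : T 0 = 0.
  by apply: (addrI (1 *: T 0)); rewrite -Tl scaler0 !addr0 scale1r.
elim: r => [|i r IH]; first by rewrite !big_nil.
by rewrite !big_cons -{1}[F i]scale1r Tl IH scale1r.
Qed.

Section Correspondence.
Variables (R : realType) (G : graph) (A : vertex G -> unitalCstarAlgType R).
Variable phi : forall e : edge G, A (src e) -> A (rng e).
Arguments phi : clear implicits.
Hypotheses (phi_hom : forall e, star_hom (phi e))
  (phi_unital : forall e, phi e cone = cone).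

Let AA : cstarAlgType R := dsum (fun v => A v : cstarAlgType R).
Let X := mw_correspondence phi.
Implicit Types (a b : AA) (v : vertex G) (e f : edge G) (xi eta zeta : X).

Definition edge_unit e : X :=
  @fam_in R (edge G) (fun e => A (rng e) : lmodType R[i]) e cone.

Lemma corrP xi eta : (forall e, xi e = eta e) -> xi = eta.
Proof. by move=> h; apply: functional_extensionality_dep. Qed.

Lemma edge_unit_same e : edge_unit e e = cone.
Proof. by rewrite /edge_unit /fam_in dfwithin. Qed.

Lemma edge_unit_other e f : e != f -> edge_unit e f = 0.
Proof. by move=> ef; rewrite /edge_unit /fam_in dfwithout. Qed.

Lemma corrDE xi eta e : (xi + eta) e = xi e + eta e. Proof. by []. Qed.
Lemma corrZE (k : R[i]) xi e : (k *: xi) e = k *: (xi e). Proof. by []. Qed.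
Lemma corr_sumE (J : Type) (r : seq J) (Q : pred J) (F : J -> X) e :
  (\sum_(j <- r | Q j) F j) e = \sum_(j <- r | Q j) F j e.
Proof. by apply: (big_morph (fun xi : X => xi e)). Qed.
Lemma ractE xi a e : ract xi a e = xi e ** a (rng e). Proof. by []. Qed.
Lemma lactE a xi e : lact a xi e = phi e (a (src e)) ** xi e. Proof. by []. Qed.
Lemma innerE xi eta : inner xi eta = \sum_e (summand (star (xi e) ** eta e) : AA).
Proof. by []. Qed.

Lemma inner_edge_unit e xi : inner (edge_unit e) xi = summand (xi e).
Proof.
rewrite innerE (bigD1 e)//= edge_unit_same star_cone cmul1x big1 ?addr0// => f fe.
by rewrite edge_unit_other 1?eq_sym// star0 cmul0r summand0.
Qed.

Lemma innerC xi eta : star (inner xi eta) = inner eta xi.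
Proof.
rewrite !innerE star_sum; apply: eq_bigr => e _.
by rewrite summand_star starM starK.
Qed.

Lemma inner_linear zeta (k : R[i]) xi eta :
  inner zeta (k *: xi + eta) = k *: inner zeta xi + inner zeta eta.
Proof.
rewrite !innerE scaler_sumr -big_split; apply: eq_bigr => e _ /=.
by rewrite -summandP corrDE corrZE cmulDr cmulZr.
Qed.

Lemma inner_ract zeta xi a : inner zeta (ract xi a) = inner zeta xi ** a.
Proof.
rewrite !innerE cmul_suml; apply: eq_bigr => e _.
by rewrite ractE summand_cmulr cmulA.
Qed.

Lemma inner_inj xi eta : (forall zeta, inner zeta xi = inner zeta eta) -> xi = eta.
Proof.
move=> h; apply: corrP => e; have := h (edge_unit e); rewrite !inner_edge_unit.
by move=> /(congr1 (fun a : AA => a (rng e))); rewrite !summand_same.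
Qed.

Lemma corr_decomp xi : xi = \sum_e ract (edge_unit e) (summand (xi e) : AA).
Proof.
apply: corrP => f; rewrite corr_sumE (bigD1 f)//= edge_unit_same summand_same.
rewrite cmul1x big1 ?addr0// => e ef.
by rewrite edge_unit_other// cmul0r.
Qed.

Lemma lact_edge_unit a e : lact a (edge_unit e) = ract (edge_unit e) (edge_map phi e a).
Proof.
apply: corrP => f; rewrite lactE ractE.
have [<-|ef] := eqVneq e f.
  by rewrite !edge_unit_same /edge_map summand_same cmul1x cmulx1.
by rewrite !edge_unit_other// cmul0r cmulr0.
Qed.

Lemma lact_ract a xi b : lact a (ract xi b) = ract (lact a xi) b.
Proof. by apply: corrP => e; rewrite lactE !ractE lactE cmulA. Qed.

Lemma lact_linear a (k : R[i]) xi eta :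
  lact a (k *: xi + eta) = k *: lact a xi + lact a eta.
Proof.
by apply: corrP => e; rewrite corrDE corrZE !lactE corrDE corrZE cmulDr cmulZr.
Qed.

(** The edge units are a finite basis, so each element acts as a finite-rank operator. Thus [J(X)]
    is the whole direct sum and covariance can be applied to every [a]. *)
Lemma lact_rank_one a : lact a =
  fun zeta : X => \sum_(p <- [seq (lact a (edge_unit e), edge_unit e) | e : edge G])
    rank_one p.1 p.2 zeta.
Proof.
apply/funext => zeta; rewrite big_map big_enum.
rewrite {1}(corr_decomp zeta) (linear_sum (T := lact a) _ _ (lact_linear a)).
by apply: eq_bigr => e _; rewrite /rank_one inner_edge_unit lact_ract.
Qed.

Lemma adjoint_inner (T U : X -> X) zeta xi : is_adjoint T U ->
  inner zeta (T xi) = inner (U zeta) xi.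
Proof. by move=> TU; rewrite -innerC TU innerC. Qed.

(** Operators are bare functions here; having an adjoint forces linearity because the inner product
    separates points ([inner_inj]). *)
Lemma adjointable_linear (T : X -> X) : adjointable T ->
  forall (k : R[i]) xi eta, T (k *: xi + eta) = k *: T xi + T eta.
Proof.
move=> [U TU] k xi eta; apply: inner_inj => zeta.
by rewrite inner_linear !(adjoint_inner _ _ TU) inner_linear.
Qed.

Lemma adjointable_ract (T : X -> X) : adjointable T ->
  forall xi a, T (ract xi a) = ract (T xi) a.
Proof.
move=> [U TU] xi a; apply: inner_inj => zeta.
by rewrite inner_ract !(adjoint_inner _ _ TU) inner_ract.
Qed.

Lemma rank_one_adjoint xi eta : is_adjoint (rank_one xi eta) (rank_one eta xi).
Proof.
move=> zeta chi; rewrite /rank_one inner_ract -innerC inner_ract starM.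
by rewrite !innerC.
Qed.

Lemma compact_op_finite_rank (s : seq (X * X)) :
  compact_op (fun zeta : X => \sum_(p <- s) rank_one p.1 p.2 zeta).
Proof.
split; last first.
  move=> eps eps0; exists s => zeta; rewrite subrr.
  have -> : corr_norm (0 : X) = 0.
    rewrite /corr_norm; have -> : inner (0 : X) 0 = 0.
      by rewrite -{2}(subrr (0 : X)) -scaleN1r addrC inner_linear scaleN1r addNr.
    by rewrite normr0 sqrtC0.
  by rewrite mulr_ge0 ?(ltW eps0)// sqrtC_ge0.
exists (fun zeta => \sum_(p <- s) rank_one p.2 p.1 zeta) => xi eta.
rewrite -innerC (linear_sum (T := inner eta) _ _ (inner_linear eta)).
rewrite star_sum (linear_sum (T := inner xi) _ _ (inner_linear xi)).
by apply: eq_bigr => p _; rewrite innerC rank_one_adjoint.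
Qed.

End Correspondence.

(** * Covariant representations built from Cuntz-Krieger families *)

Section RepresentationOfCKFamily.
Variables (R : realType) (G : graph) (A : vertex G -> unitalCstarAlgType R).
Variable phi : forall e : edge G, A (src e) -> A (rng e).
Arguments phi : clear implicits.
Hypotheses (phi_hom : forall e, star_hom (phi e))
  (phi_unital : forall e, phi e cone = cone).

Let AA : cstarAlgType R := dsum (fun v => A v : cstarAlgType R).
Let X := mw_correspondence phi.
Implicit Types (a b : AA) (v : vertex G) (e f : edge G) (xi eta zeta : X).

Variables (B : cstarAlgType R) (P : vertex G -> B) (S : edge G -> B).
Hypothesis ck : ck_family P S.
Variable theta : AA -> B.
Hypotheses (th : star_hom theta) (theta_fixed : transfer phi S theta = theta)
  (theta1 : forall v, theta (summand1 A v) = P v).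

Definition ck_psi xi : B := \sum_e S e ** theta (summand (xi e)).

Let rng_summand e (x : A (rng e)) : P (rng e) ** theta (summand x) = theta (summand x).
Proof. by rewrite -theta1 -(star_hom_cmul th) summand1_cmul summand_same. Qed.

Let star_edge_psi e xi : star (S e) ** ck_psi xi = theta (summand (xi e)).
Proof.
rewrite cmul_sumr (bigD1 e)//= cmulA (ck_edge_orthogonal ck) eqxx rng_summand.
rewrite big1 ?addr0// => f fe.
by rewrite cmulA (ck_edge_orthogonal ck) eq_sym (negPf fe) cmul0r.
Qed.

Lemma ck_psi_edge_unit e : ck_psi (edge_unit phi e) = S e.
Proof.
rewrite /ck_psi (bigD1 e)//= edge_unit_same -[summand _]/(summand1 A (rng e)).
rewrite theta1 (ck_edge_rng ck) big1 ?addr0// => f fe.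
by rewrite edge_unit_other 1?eq_sym// summand0 (star_hom0 th) cmulr0.
Qed.

Lemma ck_psi_linear (k : R[i]) xi eta :
  ck_psi (k *: xi + eta) = k *: ck_psi xi + ck_psi eta.
Proof.
rewrite /ck_psi scaler_sumr -big_split; apply: eq_bigr => e _ /=.
by rewrite corrDE corrZE summandP (star_hom_linear th) cmulDr cmulZr.
Qed.

Lemma ck_toeplitz : toeplitz_rep ck_psi theta.
Proof.
split=> //.
- exact: ck_psi_linear.
- move=> xi a; rewrite /ck_psi cmul_suml; apply: eq_bigr => e _.
  rewrite -cmulA -(star_hom_cmul th); congr (_ ** theta _).
  by rewrite ractE summand_cmulr.
(* Compatibility with the left action is where the fixed-point equation is used: [theta a] is
   expanded so that [S_e^*] meets [ck_psi xi]. *)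
- move=> a xi; rewrite -[in RHS]theta_fixed /transfer /compress cmul_suml.
  apply: eq_bigr => e _; rewrite -cmulA star_edge_psi -cmulA -(star_hom_cmul th).
  by rewrite lactE -summandM.
- move=> xi eta; rewrite /ck_psi star_sum cmul_suml innerE (star_hom_sum th).
  apply: eq_bigr => e _; rewrite starM -cmulA -/(ck_psi eta) star_edge_psi.
  by rewrite -(star_hom_star th) -(star_hom_cmul th) summand_star summandM.
Qed.

Lemma ck_range_proj_psi xi :
  \sum_e S e ** (star (S e) ** ck_psi xi) = ck_psi xi.
Proof. by apply: eq_bigr => e _; rewrite star_edge_psi. Qed.

(** An adjointable [T] is the sum over the edges of the rank-one operators given by [T 1_e] and
    [1_e], which forces this formula on them. *)
Definition ck_pi1 (T : X -> X) : B :=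
  \sum_e ck_psi (T (edge_unit phi e)) ** star (S e).

Lemma ck_pi1_induced : induced_hom ck_psi ck_pi1.
Proof.
have [_ _ psi_ract _ psi_inner] := ck_toeplitz.
split.
- move=> xi eta; rewrite -(ck_range_proj_psi eta) star_sum cmul_sumr.
  apply: eq_bigr => e _; rewrite /rank_one psi_ract -psi_inner ck_psi_edge_unit.
  by rewrite !starM starK !cmulA.
- move=> k T U _ _; rewrite /ck_pi1 scaler_sumr -big_split.
  by apply: eq_bigr => e _ /=; rewrite ck_psi_linear cmulDl cmulZl.
- move=> T U [adT _] _; rewrite /ck_pi1 cmul_sumr; apply: eq_bigr => e _.
  rewrite cmulA; congr (_ ** _); rewrite cmul_suml /=.
  rewrite {1}(corr_decomp (U (edge_unit phi e))).
  rewrite (linear_sum (T := T) _ _ (adjointable_linear adT)).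
  rewrite (linear_sum (T := ck_psi) _ _ ck_psi_linear); apply: eq_bigr => f _.
  by rewrite (adjointable_ract adT) psi_ract -cmulA star_edge_psi.
- move=> T U _ _ TU; rewrite /ck_pi1 star_sum.
  transitivity (\sum_e \sum_f S f ** (star (S f) ** ck_psi (U (edge_unit phi e)))
    ** star (S e)).
    by apply: eq_bigr => e _; rewrite -cmul_suml ck_range_proj_psi.
  rewrite exchange_big /=; apply: eq_bigr => f _.
  rewrite starM starK -[in RHS](ck_range_proj_psi (T (edge_unit phi f))).
  rewrite star_sum cmul_sumr; apply: eq_bigr => e _.
  rewrite -(ck_psi_edge_unit f) psi_inner.
  have -> : inner (edge_unit phi f) (U (edge_unit phi e)) =
    inner (T (edge_unit phi f)) (edge_unit phi e) by rewrite TU.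
  rewrite -psi_inner !ck_psi_edge_unit !starM starK !cmulA.
  by [].
Qed.

Lemma ck_covariant : cp_covariant ck_psi theta.
Proof.
exists ck_pi1; first exact: ck_pi1_induced.
have [_ _ psi_ract _ _] := ck_toeplitz.
move=> a _; rewrite -[RHS](congr1 (fun g => g a) theta_fixed); apply: eq_bigr => e _.
by rewrite lact_edge_unit psi_ract ck_psi_edge_unit.
Qed.

End RepresentationOfCKFamily.

(** * The Cuntz-Krieger family of a covariant representation *)

Section CuntzPimsnerFamily.
Variables (R : realType) (G : graph) (A : vertex G -> unitalCstarAlgType R).
Variable phi : forall e : edge G, A (src e) -> A (rng e).
Arguments phi : clear implicits.
Hypotheses (phi_hom : forall e, star_hom (phi e))
  (phi_unital : forall e, phi e cone = cone).

Let AA : cstarAlgType R := dsum (fun v => A v : cstarAlgType R).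
Let X := mw_correspondence phi.
Implicit Types (a b : AA) (v : vertex G) (e f : edge G) (xi eta zeta : X).

Variables (O : cstarAlgType R) (psi : X -> O) (pi : AA -> O).
Hypotheses (ht : toeplitz_rep psi pi) (hcov : cp_covariant psi pi).

Definition cp_proj v : O := pi (summand1 A v).
Definition cp_edge e : O := psi (edge_unit phi e).

Let pih := toeplitz_hom ht.

Let psi_lin (k : R[i]) xi eta : psi (k *: xi + eta) = k *: psi xi + psi eta.
Proof. exact: (toeplitz_linear ht). Qed.

Lemma psi_decomp xi : psi xi = \sum_e cp_edge e ** pi (summand (xi e)).
Proof.
rewrite {1}(corr_decomp xi) (linear_sum (T := psi) _ _ psi_lin).
by apply: eq_bigr => e _; rewrite (toeplitz_ract ht).
Qed.

Lemma induced_finite_rank (pi1 : (X -> X) -> O) (s : seq (X * X)) :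
  induced_hom psi pi1 ->
  pi1 (fun zeta => \sum_(p <- s) rank_one p.1 p.2 zeta) =
  \sum_(p <- s) psi p.1 ** star (psi p.2).
Proof.
move=> h1; elim: s => [|p s IH].
  rewrite big_nil.
  have psi0 : psi 0 = 0.
    by apply: (addrI (1 *: psi 0)); rewrite -psi_lin scaler0 !addr0 scale1r.
  (* [induced_hom] does not mention the zero operator, which is therefore written as a rank-one
     operator. *)
  have -> : (fun zeta : X => \sum_(p <- [::]) rank_one p.1 p.2 zeta) =
      rank_one (0 : X) 0.
    apply/funext => zeta; rewrite big_nil; apply: corrP => e.
    by rewrite /rank_one ractE; apply/esym; exact: cmul0r.
  by rewrite (induced_rank_one h1) psi0 cmul0r.
have -> : (fun zeta : X => \sum_(q <- p :: s) rank_one q.1 q.2 zeta) =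
    (fun zeta => 1 *: rank_one p.1 p.2 zeta + \sum_(q <- s) rank_one q.1 q.2 zeta).
  by apply/funext => zeta; rewrite big_cons scale1r.
have cr : compact_op (rank_one p.1 p.2).
  have := compact_op_finite_rank [:: p].
  by under [X in compact_op X -> _]eq_fun do rewrite big_seq1.
rewrite (induced_linear h1) //; last exact: compact_op_finite_rank.
by rewrite (induced_rank_one h1) IH scale1r big_cons.
Qed.

(** [lact a] is the sum of the rank-one operators given by [1_e Phi_e(a)] and [1_e]; its image under
    [pi1] is the transfer of [pi], and covariance equates it with [pi a]. *)
Lemma pi_transfer : transfer phi cp_edge pi = pi.
Proof.
have [pi1 h1 hpi] := hcov; apply/funext => a.
have ca : compact_op (lact a : X -> X).
  by rewrite lact_rank_one; exact: compact_op_finite_rank.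
rewrite -[RHS](hpi a ca) lact_rank_one (induced_finite_rank _ h1).
rewrite big_map big_enum; apply: eq_bigr => e _.
by rewrite -(toeplitz_ract ht) -lact_edge_unit.
Qed.

Lemma cp_ck_family : ck_family cp_proj cp_edge.
Proof.
have proj v : summand1 A v ** summand1 A v = summand1 A v.
  by rewrite summand1_cmul /summand1 summand_same.
have edge_rng e : cp_edge e ** cp_proj (rng e) = cp_edge e.
  rewrite -(toeplitz_ract ht); congr psi; apply: corrP => f; rewrite ractE.
  have [<-|ef] := eqVneq e f; first by rewrite edge_unit_same /summand1 summand_same cmulx1.
  by rewrite edge_unit_other// cmul0r.
have edge_src e : star (cp_edge e) ** cp_edge e = cp_proj (rng e).
  by rewrite (toeplitz_inner ht) inner_edge_unit edge_unit_same.
split=> //.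
- move=> v; rewrite /cp_proj -(star_hom_star pih) -(star_hom_cmul pih) proj.
  by rewrite /summand1 summand_star star_cone.
- move=> v w vw; rewrite /cp_proj -(star_hom_cmul pih) summand1_cmul.
  by rewrite /summand1 summand_other 1?eq_sym// summand0 (star_hom0 pih).
- by move=> e; rewrite -cmulA edge_src edge_rng.
(* The summation relation is the recursion at the vertex unit, where [edge_map1] leaves only the
   edges with source [v]. *)
- move=> v _; rewrite /cp_proj -[in LHS]pi_transfer [RHS]big_mkcond.
  apply: eq_bigr => e _; rewrite edge_map1//.
  case: eqVneq => _; last by rewrite (star_hom0 pih) cmulr0 cmul0r.
  by rewrite -/(cp_proj _) edge_rng.
Qed.

End CuntzPimsnerFamily.

(** * The isomorphism *)

(** Star homomorphisms carry no continuity assumption; closedness of the fixed set comes from their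
    contractivity. *)
Lemma cstar_subalgebra_fixed (R : realType) (A : cstarAlgType R) (f : A -> A) :
  star_hom f -> cstar_subalgebra [set x | f x = x].
Proof.
move=> fh; split=> /=.
- exact: star_hom0 fh.
- by move=> x y; rewrite /= (star_homD fh) => -> ->.
- by move=> k x; rewrite /= (star_homZ fh) => ->.
- by move=> x y; rewrite /= (star_hom_cmul fh) => -> ->.
- by move=> x; rewrite /= (star_hom_star fh) => ->.
move=> x cx; apply/subr0_eq/nm_small_eq0 => e e0.
have e2 : 0 < e / 2 by rewrite divr_gt0.
have [|y [/= fy xy]] := cx (ball x (e / 2)%:C).
  by apply: nbhsx_ballx; rewrite ltcR.
move: xy; rewrite -ball_normE /= -nmE ltcR => /ltW xy.
have -> : f x - x = (f x - f y) - (x - y).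
  by rewrite fy; linear_combination R[i].
rewrite (le_trans (nmB _ _))// [leRHS]splitr lerD//.
exact: le_trans (nm_star_homB fh _ _) xy.
Qed.

Lemma star_hom_id_of_generated (R : realType) (A : cstarAlgType R) (f : A -> A)
    (gens : set A) : star_hom f -> cstar_generated gens ->
  (forall x, gens x -> f x = x) -> forall x, f x = x.
Proof.
move=> fh gen fx x; have := gen _ (cstar_subalgebra_fixed fh) fx.
by move=> /(congr1 (fun D : set A => D x)) /=; rewrite propeqE => -[_]; exact.
Qed.

Theorem mainTheorem4 (R : realType) (G : graph)
    (A : vertex G -> unitalCstarAlgType R)
    (Lip : forall v, set (A v)) (L : forall v, A v -> R)
    (phi : forall e : edge G, A (src e) -> A (rng e))
    (hMW : nc_mauldin_williams phi Lip L)
    (hsinks : no_sinks G) (hsources : no_sources G)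
    (K : forall v, set (functional (A v)))
    (hK : invariant_family phi K)
    (hhull : forall v, states (A v) = closed_convex_hull (K v))
    (O : cstarAlgType R) (psi : mw_correspondence phi -> O)
    (pi : dsum (fun v => A v) -> O)
    (hO : cuntz_pimsner (mw_correspondence phi) psi pi)
    (C : cstarAlgType R) (P : vertex G -> C) (S : edge G -> C)
    (hC : graph_cstar_algebra P S) :
  cstar_isomorphic O C.
Proof.
have phi_hom := mw_hom hMW; have phi_unital := mw_unital hMW.
have almost_scalar := word_map_almost_scalar hMW.
have ckC := graph_ck hC.
have ht := cp_toeplitz hO.
have ckO := cp_ck_family phi_hom phi_unital ht (cp_cov hO).
pose nu v := sval (cid (exists_state (A v))).
have nus v : is_state (nu v) := svalP (cid (exists_state (A v))).
have [theta [th tfix theta1]] :=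
  exists_transfer_fixed phi_hom phi_unital almost_scalar ckC nus hsinks.
have [h [hh hpsi hpi]] := cp_universal hO
  (ck_toeplitz ckC th tfix theta1) (ck_covariant ckC th tfix theta1).
have [g [gh gP gS]] := graph_universal hC ckO.
have hgh := star_hom_comp hh gh; have ghh := star_hom_comp gh hh.
exists h => //; exists g => x.
  apply: (star_hom_id_of_generated ghh (cp_generated hO)) => {x}.
  (* Composition with [g] carries the fixed point over [P] and [S] to one over the family in [O];
     [pi] is another with the same vertex values, so uniqueness identifies them. *)
  have gpi : g \o theta = pi.
    apply: (transfer_fixed_unique almost_scalar ckO) => //.
    - apply/funext => a; rewrite /= -[in RHS]tfix /transfer (star_hom_sum gh).
      apply: eq_bigr => e _; rewrite !(star_hom_cmul gh) (star_hom_star gh).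
      by rewrite gS.
    - exact: pi_transfer (cp_cov hO).
    - exact: star_hom_comp gh th.
    - exact: toeplitz_hom ht.
    - by move=> v; rewrite /= theta1 gP.
  have gpiE a : g (theta a) = pi a := congr1 (fun f => f a) gpi.
  move=> _ [[xi _ <-]|[a _ <-]] /=; last by rewrite hpi gpiE.
  rewrite hpsi (psi_decomp ht) (star_hom_sum gh); apply: eq_bigr => e _.
  by rewrite (star_hom_cmul gh) gS gpiE.
apply: (star_hom_id_of_generated hgh (graph_generated hC)) => {x}.
move=> _ [[v _ <-]|[e _ <-]] /=; first by rewrite gP hpi theta1.
by rewrite gS hpsi (ck_psi_edge_unit phi ckC th theta1).
Qed.
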